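(* Let $n\ge1$, let $x_1,\dots,x_n\in\mathbb{R}$ be distinct, let $w_1,\dots,w_n\in\mathbb{R}$ and $v_1,\dots,v_n\ge 0$, and suppose that the Pick matrix of the corresponding Problem $\partial NP\mathcal{P}$ is positive definite. There exist $$s_1,\dots,s_n\in\mathbb{R}\cup\{\infty\},\qquad t_1,\dots,t_n>0,\qquad y_1,\dots,y_n\in\mathbb{R}\cup\{\infty\}$$ such that the general solution of Problem $\partial NP\mathcal{P}$ is $f=f_1$ where the functions $f_{n+1},\dots,f_1$ are given recursively by: (1) $f_{n+1}$ is any function in $\mathcal{P}$ that is meromorphic at $x_1,\dots,x_n$ and satisfies $f_{n+1}(x_j)\ne y_j$ for $j=1,\dots,n$; (2) $f_k$ is the augmentation of $f_{k+1}$ at $x_k$ by $s_k,t_k$, for $k=n,\dots,1$. (That is, the set of solutions is exactly the set of functions $f_1$ obtained in this way.) The quantities $s_j,t_j,y_j$ are given explicitly by $s_j=w^j_j$, $t_j=v^j_j$, $y_j=y^{n+1}_j$ for $j=1,\dots,n$, where $w^k_j,v^k_j$ ($1\le k\le j\le n$) and $y^k_j$ ($1\le j<k\le n+1$) are the quantities defined recursively from the data in the context.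
   Context: $\Pi=\{z\in\mathbb{C}:\operatorname{Im} z>0\}$. The Pick class $\mathcal{P}$ is the set of functions analytic and with non-negative imaginary part in $\Pi$. A function $f\in\mathcal{P}$ is analytic (meromorphic) at $x\in\mathbb{R}$ if it extends analytically (meromorphically) to a neighbourhood of $x$ in $\mathbb{C}$; its value at $x$ is that of the extension, with value $\infty$ at a pole. Problem $\partial NP\mathcal{P}$: find all $f\in\mathcal{P}$, analytic at $x_1,\dots,x_n$, with $f(x_j)=w_j$, $f'(x_j)=v_j$ for $j=1,\dots,n$ (such $f$ are the solutions). Its Pick matrix is $M=[m_{ij}]_{i,j=1}^n$ with $m_{ii}=v_i$ and $m_{ij}=\frac{w_i-w_j}{x_i-x_j}$ for $i\neq j$. Augmentation: for $g\in\mathcal{P}$ meromorphic at $x\in\mathbb{R}$, $a_0\in\mathbb{R}\cup\{\infty\}$ and $a_1>0$, the augmentation of $g$ at $x$ by $a_0,a_1$ is the function $f$ on $\Pi$ given by $$\frac{1}{f(z)-a_0}=\frac{1}{a_1(z-x)}-g(z)\ \text{ if } a_0\in\mathbb{R},\qquad f(z)=g(z)-\frac{1}{a_1(z-x)}\ \text{ if } a_0=\infty .$$ Recursive quantities: $w^1_j=w_j$, $v^1_j=v_j$ for $j=1,\dots,n$, and for $2\le k+1\le j\le n$ $$w^{k+1}_j=\begin{cases}\frac{1}{v^k_k(x_j-x_k)} & \text{if } w^k_k\in\mathbb{R},\ w^k_j=\infty\\ -\frac{1}{w^k_j-w^k_k}+\frac{1}{v^k_k(x_j-x_k)} & \text{if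 } w^k_k,w^k_j\in\mathbb{R},\ w^k_j\ne w^k_k\\ w^k_j+\frac{1}{v^k_k(x_j-x_k)} & \text{if } w^k_k=\infty,\ w^k_j\in\mathbb{R}\\ \infty & \text{if } w^k_k=w^k_j,\end{cases}$$ $$v^{k+1}_j=\begin{cases} v^k_j-\frac{1}{v^k_k(x_j-x_k)^2} & \text{if exactly one of } w^k_k,w^k_j \text{ is } \infty\\ \frac{v^k_j}{(w^k_j-w^k_k)^2}-\frac{1}{v^k_k(x_j-x_k)^2} & \text{if } w^k_k,w^k_j\in\mathbb{R},\ w^k_j\ne w^k_k\\ v^k_j & \text{if } w^k_k=w^k_j.\end{cases}$$ Further $y^k_{k-1}=\infty$ for $k=2,\dots,n+1$ and, for $1\le j<k\le n$, $$y^{k+1}_j=\begin{cases}-\frac{1}{y^k_j-w^k_k}+\frac{1}{v^k_k(x_j-x_k)} & \text{if } w^k_k\in\mathbb{R}\\ y^k_j+\frac{1}{v^k_k(x_j-x_k)} & \text{if } w^k_k=\infty,\end{cases}$$ with the natural interpretations when $y^k_j=\infty$ or $y^k_j=w^k_k$ (i.e. $1/\infty=0$, $1/0=\infty$, $\infty+c=\infty$ for $c\in\mathbb{R}$). *)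

(* Defs.v *)
From Stdlib Require Import Reals.
From Coquelicot Require Import Coquelicot.

Open Scope R_scope.

(** One-point extension: [onept R] is the real line with a single point at
    infinity (not the two-ended [Rbar]), [onept C] is the Riemann sphere. *)
Inductive onept (T : Type) : Type :=
  | Fin : T -> onept T
  | Inf : onept T.

Arguments Fin {T} _.
Arguments Inf {T}.

Definition onept_RtoC (a : onept R) : onept C :=
  match a with
  | Fin r => Fin (RtoC r)
  | Inf => Inf
  end.

(** * Analytic and meromorphic functions *)

Definition upper_half_plane (z : C) : Prop := 0 < Im z.

Definition disc (c : C) (r : R) (z : C) : Prop := Cmod (z - c)%C < r.

Definition analytic_at (f : C -> C) (c : C) : Prop :=
  exists (a : nat -> C) (r : R),
    0 < r /\ forall z : C, disc c r z -> is_pseries a (z - c)%C (f z).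

(** A sphere-valued function is meromorphic at [c] if near [c] it is either
    finite and analytic, or has a pole of some order [m >= 1] at [c], where it
    takes the value [Inf]. *)
Definition meromorphic_pt (F : C -> onept C) (c : C) : Prop :=
  (exists (h : C -> C) (r : R),
      0 < r /\ analytic_at h c /\
      forall z : C, disc c r z -> F z = Fin (h z))
  \/
  (exists (m : nat) (h : C -> C) (r : R),
      (1 <= m)%nat /\ 0 < r /\ analytic_at h c /\ h c <> RtoC 0 /\
      F c = Inf /\
      forall z : C, disc c r z -> z <> c -> F z = Fin (h z / Cpow (z - c) m)%C).

(** Functions on the upper half-plane are represented by total functions on [C]
    whose values elsewhere are irrelevant. In particular the extensions below
    are only required to agree with [f] inside the half-plane. *)

Definition analytic_extension (f : C -> C) (x : R) (F : C -> C) : Prop :=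
  exists r : R, 0 < r /\
    (forall z : C, disc (RtoC x) r z -> analytic_at F z) /\
    (forall z : C, disc (RtoC x) r z -> upper_half_plane z -> F z = f z).

Definition meromorphic_extension (f : C -> C) (x : R) (F : C -> onept C) : Prop :=
  exists r : R, 0 < r /\
    (forall z : C, disc (RtoC x) r z -> meromorphic_pt F z) /\
    (forall z : C, disc (RtoC x) r z -> upper_half_plane z -> F z = Fin (f z)).

Definition meromorphic_at (f : C -> C) (x : R) : Prop :=
  exists F : C -> onept C, meromorphic_extension f x F.

Definition Pick_class (f : C -> C) : Prop :=
  forall z : C, upper_half_plane z -> analytic_at f z /\ 0 <= Im (f z).

(** * The boundary Nevanlinna-Pick problem

    Finite families indexed by 1, ..., n are functions on [nat] of which only
    the entries 1, ..., n matter. *)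

Definition dNPP_solution (n : nat) (x w v : nat -> R) (f : C -> C) : Prop :=
  Pick_class f /\
  forall j : nat, (1 <= j <= n)%nat ->
    exists F : C -> C,
      analytic_extension f (x j) F /\
      F (RtoC (x j)) = RtoC (w j) /\
      is_derive F (RtoC (x j)) (RtoC (v j)).

Definition Pick_matrix (x w v : nat -> R) (i j : nat) : R :=
  if Nat.eqb i j then v i else (w i - w j) / (x i - x j).

Definition positive_definite (n : nat) (M : nat -> nat -> R) : Prop :=
  forall c : nat -> R,
    (exists j : nat, (1 <= j <= n)%nat /\ c j <> 0) ->
    0 < sum_n_m (fun i => sum_n_m (fun j => c i * M i j * c j) 1 n) 1 n.

(** * Augmentation *)

(** [f] is the augmentation of [g] at [x] by [a0], [a1]; the side condition
    [f z <> a0] makes the left-hand reciprocal a genuine one. *)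
Definition is_augmentation (g : C -> C) (x : R) (a0 : onept R) (a1 : R)
    (f : C -> C) : Prop :=
  Pick_class g /\ meromorphic_at g x /\ 0 < a1 /\
  forall z : C, upper_half_plane z ->
    match a0 with
    | Fin a => f z <> RtoC a /\
        (1 / (f z - RtoC a) = 1 / (RtoC a1 * (z - RtoC x)) - g z)%C
    | Inf => (f z = g z - 1 / (RtoC a1 * (z - RtoC x)))%C
    end.

(** * The recursive quantities *)

(** From the superscript-[k] families [w], [v] to the superscript-[k+1] ones. *)
Definition w_step (x : nat -> R) (k : nat) (w : nat -> onept R) (v : nat -> R)
    (j : nat) : onept R :=
  match w k, w j with
  | Fin _, Inf => Fin (1 / (v k * (x j - x k)))
  | Fin a, Fin b =>
      if Req_EM_T b a then Inf
      else Fin (- (1 / (b - a)) + 1 / (v k * (x j - x k)))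
  | Inf, Fin b => Fin (b + 1 / (v k * (x j - x k)))
  | Inf, Inf => Inf
  end.

Definition v_step (x : nat -> R) (k : nat) (w : nat -> onept R) (v : nat -> R)
    (j : nat) : R :=
  match w k, w j with
  | Fin _, Inf | Inf, Fin _ => v j - 1 / (v k * (x j - x k) ^ 2)
  | Fin a, Fin b =>
      if Req_EM_T b a then v j
      else v j / (b - a) ^ 2 - 1 / (v k * (x j - x k) ^ 2)
  | Inf, Inf => v j
  end.

(** [wv_rec x w v k] is the pair of families with superscript [k]; only the
    entries with [1 <= k <= j <= n] are meaningful. *)
Fixpoint wv_rec (x w v : nat -> R) (k : nat) : (nat -> onept R) * (nat -> R) :=
  match k with
  | O => (fun j => Fin (w j), v)
  | S k' =>
      match k' with
      | O => (fun j => Fin (w j), v)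
      | S _ =>
          let p := wv_rec x w v k' in
          (w_step x k' (fst p) (snd p), v_step x k' (fst p) (snd p))
      end
  end.

Definition w_rec (x w v : nat -> R) (k j : nat) : onept R :=
  fst (wv_rec x w v k) j.

Definition v_rec (x w v : nat -> R) (k j : nat) : R :=
  snd (wv_rec x w v k) j.

(** [y_rec x w v k j] is meaningful for [1 <= j < k]. *)
Fixpoint y_rec (x w v : nat -> R) (k j : nat) : onept R :=
  match k with
  | O => Inf
  | S k' =>
      if Nat.eqb j k' then Inf
      else
        match w_rec x w v k' k', y_rec x w v k' j with
        | Fin a, Fin y =>
            if Req_EM_T y a then Inf
            else Fin (- (1 / (y - a)) + 1 / (v_rec x w v k' k' * (x j - x k')))
        | Fin _, Inf => Fin (1 / (v_rec x w v k' k' * (x j - x k')))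
        | Inf, Fin y => Fin (y + 1 / (v_rec x w v k' k' * (x j - x k')))
        | Inf, Inf => Inf
        end
  end.

(** * The recursive parametrization *)

Definition admissible_parameter (n : nat) (x : nat -> R) (y : nat -> onept R)
    (g : C -> C) : Prop :=
  Pick_class g /\
  forall j : nat, (1 <= j <= n)%nat ->
    exists F : C -> onept C,
      meromorphic_extension g (x j) F /\
      F (RtoC (x j)) <> onept_RtoC (y j).

Definition augmentation_chain (n : nat) (x : nat -> R) (s : nat -> onept R)
    (t : nat -> R) (fs : nat -> C -> C) : Prop :=
  forall k : nat, (1 <= k <= n)%nat ->
    is_augmentation (fs (S k)) (x k) (s k) (t k) (fs k).

(* Main.v *)
(** Write [tau = 1 / (t (z - x_k))].  The step [f_k = a + 1 / (tau - f_{k+1})], or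
    [f_k = f_{k+1} - tau] when [s_k] is infinite, is a Moebius map with inverse
    [f_{k+1} = -1 / (f_k - a) + tau], and the recursive quantities are what it does to
    values and first derivatives at the other nodes.  Augmenting visibly preserves the
    Pick class and creates the jet [(s_k, t_k)] at [x_k]; reducing preserves it by
    Julia's lemma, since [-1 / (f_k - a)] and [-tau] have the same polar part at [x_k].
    All divisions by [v^k_j] are legitimate because [v^k_j > 0]: up to a diagonal
    scaling, one step of the recursion replaces the Pick matrix, extended to infinite
    values, by its Schur complement with respect to the entry [(k, k)]. *)

Require Import Defs.
From Stdlib Require Import Reals Lra Lia Psatz.
From Stdlib Require ClassicalEpsilon Classical_Prop.
From Coquelicot Require Import Coquelicot.

Open Scope R_scope.

(** The values [y_j] are the traces of the nodes already treated. A reduction at [x_k] has its pole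
    cancelled there, so it avoids [Inf]; conversely, finiteness at [x_k] is what an augmentation
    turns into the prescribed jet. The later Moebius maps merely transport the forbidden value.
    Hence jets at the nodes [k, .., n] together with forbidden values at the nodes [1, .., k - 1]
    form a single invariant, carried up by reductions and down by augmentations. Intermediate values
    may be infinite and parameters may have poles, so both conditions are kept in a pole-free form:
    a jet by a difference quotient, a forbidden value by homogeneous coordinates. Each transfer then
    becomes a [field] identity between functions analytic near the node. Two facts about the whole
    half-plane are needed: the minimum argument behind Julia's lemma, and the rigidity of a Pick
    function that takes a real value. Since [t_k > 0], rigidity keeps [f_k] off a finite [s_k], so
    that the reduction has no pole in the half-plane. *)

Lemma Cmod_minus_sym (a b : C) : Cmod (a - b) = Cmod (b - a).
Proof. rewrite <- Cmod_opp. f_equal. ring. Qed.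

Lemma Cmod_minus_le (a b : C) : Cmod (a - b) <= Cmod a + Cmod b.
Proof.
  unfold Cminus. generalize (Cmod_triangle a (- b)). rewrite Cmod_opp. lra.
Qed.

Lemma Cmod_le_minus (a b : C) : Cmod a - Cmod b <= Cmod (a - b).
Proof.
  generalize (Cmod_triangle (a - b) b). replace (a - b + b)%C with a by ring. lra.
Qed.

Lemma im_le_Cmod (c : C) : Rabs (Im c) <= Cmod c.
Proof.
  generalize (Rmax_Cmod c) (Rmax_r (Rabs (fst c)) (Rabs (snd c))). unfold Im. lra.
Qed.

Lemma pow_n_Cpow (h : C) (k : nat) : pow_n (K := C_Ring) h k = Cpow h k.
Proof. induction k as [|k IH]; [reflexivity|]. simpl. now rewrite IH. Qed.

(** * Power series and iterated difference quotients *)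

(** The balls of the uniform structure on [C] are componentwise; [sqrt 2] is the cost of passing
    from them to the modulus. *)
Lemma is_series_C_alt (a : nat -> C) (l : C) :
  is_series (V := C_NormedModule) a l <->
  forall eps, 0 < eps -> exists N, forall n, (N <= n)%nat ->
    Cmod (sum_n (G := C_AbelianMonoid) a n - l) < eps.
Proof.
  split.
  - intros H eps He.
    assert (He' : 0 < eps / sqrt 2).
    { apply Rdiv_lt_0_compat; [exact He|]. apply sqrt_lt_R0; lra. }
    destruct (H (ball (M := C_UniformSpace) l (mkposreal _ He'))) as [N HN].
    { exists (mkposreal _ He'). intros y Hy. exact Hy. }
    exists N. intros n Hn.
    specialize (HN n Hn). apply C_NormedModule_mixin_compat2 in HN.
    simpl in HN. replace (sqrt 2 * (eps / sqrt 2)) with eps in HN; [exact HN|].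
    field. apply Rgt_not_eq, sqrt_lt_R0; lra.
  - intros H P [eps HP].
    destruct (H eps (cond_pos eps)) as [N HN].
    exists N. intros n Hn. apply HP. apply C_NormedModule_mixin_compat1.
    exact (HN n Hn).
Qed.

Lemma is_series_C_le (a : nat -> C) (l : C) (B : R) :
  is_series (V := C_NormedModule) a l ->
  (forall n, Cmod (sum_n (G := C_AbelianMonoid) a n) <= B) -> Cmod l <= B.
Proof.
  intros H HB. apply Rnot_lt_le. intros Hlt.
  destruct (proj1 (is_series_C_alt a l) H (Cmod l - B)) as [N HN]; [lra|].
  specialize (HN N (le_n N)). specialize (HB N).
  rewrite Cmod_minus_sym in HN.
  generalize (Cmod_le_minus l (sum_n (G := C_AbelianMonoid) a N)). lra.
Qed.

Lemma is_series_C_bounded (a : nat -> C) (l : C) :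
  is_series (V := C_NormedModule) a l -> exists B, forall n, Cmod (a n) <= B.
Proof.
  intros H. destruct (proj1 (is_series_C_alt a l) H 1 Rlt_0_1) as [N HN].
  assert (Hf : forall M, exists B, forall n, (n <= M)%nat -> Cmod (a n) <= B).
  { induction M as [|M [B HB]].
    - exists (Cmod (a 0%nat)). intros n Hn. replace n with 0%nat by lia. lra.
    - exists (Rmax B (Cmod (a (S M)))). intros n Hn.
      destruct (Nat.eq_dec n (S M)) as [->|Hne]; [apply Rmax_r|].
      apply Rle_trans with B; [apply HB; lia | apply Rmax_l]. }
  destruct (Hf N) as [B HB].
  (* Beyond [N], consecutive partial sums both lie within [1] of [l], so their difference, a term,
     is below [2]. *)
  exists (Rmax B 2). intros n.
  destruct (Nat.le_gt_cases n N) as [Hn|Hn].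
  - apply Rle_trans with B; [apply HB; lia | apply Rmax_l].
  - destruct n as [|n]; [lia|].
    generalize (HN n ltac:(lia)) (HN (S n) ltac:(lia)) (Rmax_r B 2).
    rewrite sum_Sn. change plus with Cplus.
    set (s := sum_n a n). intros H1 H2 H3.
    replace (a (S n)) with ((s + a (S n) - l) - (s - l))%C by ring.
    generalize (Cmod_minus_le (s + a (S n) - l) (s - l)). lra.
Qed.

(** [E N] is the [N]-th iterated difference quotient of [F] at [c], as a
    function of the increment, so that [E N 0] is the [N]-th Taylor coefficient.
    A geometric bound on these quotients makes closure under products and
    inverses a matter of algebraic identities. *)
Definition quotients (F : C -> C) (c : C) (E : nat -> C -> C) (A rho r : R) : Prop :=
  0 < rho /\ 0 < r /\
  forall h, Cmod h < r ->
    E 0%nat h = F (c + h)%C /\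
    forall N, E N h = (E N 0 + h * E (S N) h)%C /\ Cmod (E N h) <= A * rho ^ N.

(** The sum of the series with coefficients [a N, a (N + 1), ..], obtained algebraically by peeling
    coefficients off [F] instead of as a new limit. At [h = 0] the quotient is replaced by the
    coefficient it must tend to. *)
Fixpoint shifted_sum (F : C -> C) (c : C) (a : nat -> C) (N : nat) (h : C) : C :=
  match N with
  | O => F (c + h)%C
  | S N => if Ceq_dec h 0 then a (S N)
           else ((shifted_sum F c a N h - a N) / h)%C
  end.

Lemma shifted_sum_is_series F c a h N :
  is_series (V := C_NormedModule) (fun k => (Cpow h k * a k)%C) (F (c + h)%C) ->
  is_series (V := C_NormedModule)
    (fun k => (Cpow h k * a (N + k)%nat)%C) (shifted_sum F c a N h).
Proof.
  intros H0. induction N as [|N IH]; [exact H0|].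
  simpl. destruct (Ceq_dec h 0) as [->|Hh].
  - apply is_series_C_alt. intros eps He. exists 0%nat. intros n _.
    assert (Hs : sum_n (G := C_AbelianMonoid)
                   (fun k => (Cpow 0 k * a (S (N + k)))%C) n = a (S N)).
    { induction n as [|n IHn].
      - rewrite sum_O. simpl. rewrite Nat.add_0_r. ring.
      - rewrite sum_Sn, IHn. change plus with Cplus. simpl. ring. }
    rewrite Hs. replace (a (S N) - a (S N))%C with (RtoC 0) by ring.
    now rewrite Cmod_0.
  - apply is_series_C_alt. intros eps He.
    pose proof (proj1 (Cmod_gt_0 h) Hh) as Hh'.
    destruct (proj1 (is_series_C_alt _ _) IH (eps * Cmod h)) as [M HM].
    { now apply Rmult_lt_0_compat. }
    exists M. intros n Hn. specialize (HM (S n) ltac:(lia)).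
    assert (Hs : forall n, sum_n (G := C_AbelianMonoid)
                   (fun k => (Cpow h k * a (N + k)%nat)%C) (S n) =
                 (a N + h * sum_n (G := C_AbelianMonoid)
                   (fun k => (Cpow h k * a (S (N + k)))%C) n)%C).
    { clear. induction n as [|n IHn].
      - rewrite sum_Sn, !sum_O. change plus with Cplus. simpl.
        rewrite Nat.add_0_r, Nat.add_1_r. ring.
      - rewrite sum_Sn, IHn, (sum_Sn _ n). change plus with Cplus.
        rewrite (Nat.add_succ_r N (S n)). simpl. ring. }
    rewrite Hs in HM.
    set (s := sum_n _ _) in *.
    replace (s - (shifted_sum F c a N h - a N) / h)%C
      with ((a N + h * s - shifted_sum F c a N h) / h)%C by (field; exact Hh).
    rewrite Cmod_div by exact Hh.
    apply (Rmult_lt_reg_r (Cmod h)); [exact Hh'|].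
    unfold Rdiv. rewrite Rmult_assoc, Rinv_l by lra. lra.
Qed.

Lemma sum_geometric_bound (b : nat -> C) (K : R) :
  0 <= K -> (forall n, Cmod (b n) <= K * (1 / 2) ^ n) ->
  forall n, Cmod (sum_n (G := C_AbelianMonoid) b n) <= 2 * K.
Proof.
  intros HK Hb n.
  (* Subtracting the geometric tail makes the bound inductive. *)
  enough (Cmod (sum_n (G := C_AbelianMonoid) b n) <= 2 * K - K * (1 / 2) ^ n).
  { assert (0 < (1 / 2) ^ n) by (apply pow_lt; lra). nra. }
  induction n as [|n IH].
  - rewrite sum_O. specialize (Hb 0%nat). simpl in *. lra.
  - rewrite sum_Sn. change plus with Cplus.
    eapply Rle_trans; [apply Cmod_triangle|].
    specialize (Hb (S n)). simpl in *. lra.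
Qed.

Lemma quotients_of_analytic F c :
  analytic_at F c -> exists E A rho r, quotients F c E A rho r.
Proof.
  intros (a & r & Hr & H).
  assert (Hs : forall h, Cmod h < r -> is_series (V := C_NormedModule)
                 (fun k => (Cpow h k * a k)%C) (F (c + h)%C)).
  { intros h Hh. specialize (H (c + h)%C).
    unfold Defs.disc in H. replace (c + h - c)%C with h in H by ring.
    specialize (H Hh). unfold is_pseries in H.
    eapply is_series_ext; [|exact H].
    intros n. cbv beta. now rewrite pow_n_Cpow. }
  destruct (is_series_C_bounded _ _ (Hs (RtoC (r / 2)) ltac:(rewrite Cmod_R, Rabs_pos_eq; lra)))
    as [B HB].
  assert (Ha : forall k, Cmod (a k) <= B * (2 / r) ^ k).
  { intros k. specialize (HB k). rewrite Cmod_mult, Cmod_pow, Cmod_R, Rabs_pos_eq in HB by lra.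
    assert (Hp : 0 < (2 / r) ^ k) by (apply pow_lt, Rdiv_lt_0_compat; lra).
    replace (Cmod (a k)) with ((r / 2) ^ k * Cmod (a k) * (2 / r) ^ k).
    - apply Rmult_le_compat_r; lra.
    - replace ((r / 2) ^ k * Cmod (a k) * (2 / r) ^ k)
        with (((r / 2) ^ k * (2 / r) ^ k) * Cmod (a k)) by ring.
      rewrite <- Rpow_mult_distr. replace (r / 2 * (2 / r)) with 1 by (field; lra).
      rewrite pow1. ring. }
  assert (HB0 : 0 <= B).
  { generalize (Ha 0%nat) (Cmod_ge_0 (a 0%nat)). simpl. lra. }
  (* Convergence at [r / 2] bounds the coefficients by [B (2 / r)^k]. For [|h| < r / 4] the shifted
     series is dominated by a geometric series of ratio [1 / 2], whence the factor [2]. *)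
  exists (shifted_sum F c a), (2 * B), (2 / r), (r / 4).
  split; [apply Rdiv_lt_0_compat; lra|]. split; [lra|].
  intros h Hh.
  assert (Ha0 : forall N, shifted_sum F c a N 0 = a N).
  { intros [|N].
    - simpl. specialize (Hs 0%C ltac:(rewrite Cmod_0; lra)).
      apply (filterlim_locally_unique (F := eventually)
               (sum_n (G := C_AbelianMonoid) (fun k => (Cpow 0 k * a k)%C)));
        [exact Hs|].
      apply filterlim_ext with (fun _ : nat => a 0%nat).
      + intros n. induction n as [|n IHn].
        * rewrite sum_O. simpl. now rewrite Cmult_1_l.
        * rewrite sum_Sn, <- IHn. change plus with Cplus. simpl. ring.
      + apply filterlim_const.
    - simpl. destruct (Ceq_dec 0 0) as [_|Hn]; [reflexivity|]. now elim Hn. }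
  split; [reflexivity|].
  intros N. split.
  - rewrite Ha0. simpl. destruct (Ceq_dec h 0) as [->|Hh0].
    + rewrite Ha0. ring.
    + field. exact Hh0.
  - apply is_series_C_le with (fun k => (Cpow h k * a (N + k)%nat)%C).
    { apply shifted_sum_is_series, Hs. lra. }
    replace (2 * B * (2 / r) ^ N) with (2 * (B * (2 / r) ^ N)) by ring.
    assert (Hp : forall N, 0 <= (2 / r) ^ N).
    { intros M. apply pow_le, Rlt_le, Rdiv_lt_0_compat; lra. }
    apply sum_geometric_bound.
    + apply Rmult_le_pos; [lra|apply Hp].
    + intros n. rewrite Cmod_mult, Cmod_pow.
      apply Rle_trans with ((r / 4) ^ n * (B * (2 / r) ^ (N + n))).
      * apply Rmult_le_compat; [apply pow_le, Cmod_ge_0|apply Cmod_ge_0| |apply Ha].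
        apply pow_incr. split; [apply Cmod_ge_0|lra].
      * rewrite pow_add. right.
        replace (1 / 2) with ((r / 4) * (2 / r)) by (field; lra).
        rewrite Rpow_mult_distr. ring.
Qed.

Lemma quotients_expand F c E A rho r h n :
  quotients F c E A rho r -> Cmod h < r ->
  F (c + h)%C = (sum_n (G := C_AbelianMonoid) (fun k => (Cpow h k * E k 0)%C) n
                 + Cpow h (S n) * E (S n) h)%C.
Proof.
  intros (_ & _ & H) Hh. destruct (H h Hh) as [H0 HN].
  rewrite <- H0. induction n as [|n IH].
  - rewrite sum_O, (proj1 (HN 0%nat)). simpl. ring.
  - rewrite IH, sum_Sn, (proj1 (HN (S n))). change plus with Cplus. simpl. ring.
Qed.

Lemma quotients_bound_pos F c E A rho r : quotients F c E A rho r -> 0 <= A.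
Proof.
  intros (_ & Hr & H). destruct (H 0%C) as [_ H0]; [now rewrite Cmod_0|].
  generalize (proj2 (H0 0%nat)) (Cmod_ge_0 (E 0%nat 0)). simpl. lra.
Qed.

Lemma quotients_remainder F c E A rho r h n :
  quotients F c E A rho r -> Cmod h < r -> Cmod h * rho <= 1 / 2 ->
  Cmod (Cpow h n * E n h) <= A * (1 / 2) ^ n.
Proof.
  intros HE Hh Hh2. pose proof (quotients_bound_pos _ _ _ _ _ _ HE) as HA.
  destruct HE as (Hrho & Hr & H). destruct (H h Hh) as [_ HN].
  rewrite Cmod_mult, Cmod_pow.
  apply Rle_trans with (Cmod h ^ n * (A * rho ^ n)).
  - apply Rmult_le_compat_l; [apply pow_le, Cmod_ge_0|apply HN].
  - replace (Cmod h ^ n * (A * rho ^ n)) with (A * (Cmod h * rho) ^ n)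
      by (rewrite Rpow_mult_distr; ring).
    apply Rmult_le_compat_l; [exact HA|]. apply pow_incr.
    split; [|exact Hh2]. apply Rmult_le_pos; [apply Cmod_ge_0|lra].
Qed.

Lemma geometric_small A eps : 0 <= A -> 0 < eps ->
  exists N, forall n, (N <= n)%nat -> A * (1 / 2) ^ n < eps.
Proof.
  intros HA He.
  destruct (pow_lt_1_zero (1 / 2)) with (eps / (A + 1)) as [N HN].
  - rewrite Rabs_pos_eq; lra.
  - apply Rdiv_lt_0_compat; lra.
  - exists N. intros n Hn. specialize (HN n Hn).
    assert (Hp : 0 < (1 / 2) ^ n) by (apply pow_lt; lra).
    rewrite Rabs_pos_eq in HN by lra.
    apply (Rmult_lt_compat_r (A + 1)) in HN; [|lra].
    unfold Rdiv in HN at 2. rewrite Rmult_assoc, Rinv_l in HN by lra. nra.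
Qed.

(** The Taylor remainder is exactly [h^(n+1) E (n+1) h], of modulus at most [A / 2^(n+1)] once
    [|h| rho <= 1/2]; this is why the radius is cut to [1 / (2 rho)]. *)
Lemma analytic_of_quotients F c E A rho r : quotients F c E A rho r -> analytic_at F c.
Proof.
  intros HE. pose proof HE as (Hrho & Hr & _).
  exists (fun k => E k 0), (Rmin r (1 / (2 * rho))).
  assert (Hr' : 0 < 1 / (2 * rho)) by (apply Rdiv_lt_0_compat; lra).
  split; [now apply Rmin_glb_lt|].
  intros z Hz. unfold Defs.disc in Hz. set (h := (z - c)%C) in *.
  assert (Hz1 : Cmod h < r) by (eapply Rlt_le_trans; [exact Hz|apply Rmin_l]).
  assert (Hz2 : Cmod h * rho <= 1 / 2).
  { apply Rle_trans with (1 / (2 * rho) * rho).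
    - apply Rmult_le_compat_r; [lra|]. left.
      eapply Rlt_le_trans; [exact Hz|apply Rmin_r].
    - right. field. lra. }
  replace (F z) with (F (c + h)%C) by (unfold h; f_equal; ring).
  apply is_series_ext with (fun k => (Cpow h k * E k 0)%C).
  { intros k. symmetry. apply (f_equal (fun u => Cmult u (E k 0))), pow_n_Cpow. }
  apply is_series_C_alt. intros eps He.
  destruct (geometric_small A eps (quotients_bound_pos _ _ _ _ _ _ HE) He) as [N HN].
  exists N. intros n Hn.
  rewrite (quotients_expand _ _ _ _ _ _ h n HE Hz1).
  match goal with |- Cmod (?s - (?s + ?t)) < _ =>
    replace (s - (s + t))%C with (- t)%C by ring end.
  rewrite Cmod_opp.
  eapply Rle_lt_trans; [eapply quotients_remainder; eassumption|].
  apply HN. lia.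
Qed.

(** * Properties holding on a disc around a point *)

Definition near (c : C) (P : C -> Prop) : Prop :=
  exists r : R, 0 < r /\ forall z, Defs.disc c r z -> P z.

Lemma near_all (c : C) (P : C -> Prop) : (forall z, P z) -> near c P.
Proof. intros H. exists 1. split; [lra|]. auto. Qed.

Lemma near_point (c : C) (P : C -> Prop) : near c P -> P c.
Proof.
  intros (r & Hr & H). apply H. unfold Defs.disc.
  replace (c - c)%C with (RtoC 0) by ring. now rewrite Cmod_0.
Qed.

Lemma near_imp (c : C) (P Q : C -> Prop) :
  (forall z, P z -> Q z) -> near c P -> near c Q.
Proof. intros H (r & Hr & HP). exists r. auto. Qed.

Lemma near_imp2 (c : C) (P1 P2 Q : C -> Prop) :
  (forall z, P1 z -> P2 z -> Q z) -> near c P1 -> near c P2 -> near c Q.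
Proof.
  intros H (r1 & Hr1 & HP1) (r2 & Hr2 & HP2). exists (Rmin r1 r2).
  split; [now apply Rmin_glb_lt|]. unfold Defs.disc in *. intros z Hz.
  apply H; [apply HP1|apply HP2]; (eapply Rlt_le_trans; [exact Hz|]);
    [apply Rmin_l|apply Rmin_r].
Qed.

Lemma near_imp3 (c : C) (P1 P2 P3 Q : C -> Prop) :
  (forall z, P1 z -> P2 z -> P3 z -> Q z) ->
  near c P1 -> near c P2 -> near c P3 -> near c Q.
Proof.
  intros H H1 H2 H3.
  apply (near_imp2 c (fun z => P1 z /\ P2 z) P3); [| |exact H3].
  - intros z [HA HB] HC. auto.
  - now apply (near_imp2 c P1 P2).
Qed.

Lemma near_near (c : C) (P : C -> Prop) : near c P -> near c (fun z => near z P).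
Proof.
  intros (r & Hr & H). exists r. split; [exact Hr|]. intros z Hz.
  unfold Defs.disc in *. exists (r - Cmod (z - c)). split; [lra|].
  intros u Hu. apply H. unfold Defs.disc in *.
  replace (u - c)%C with ((u - z) + (z - c))%C by ring.
  eapply Rle_lt_trans; [apply Cmod_triangle|]. lra.
Qed.

Lemma near_ne (c d : C) : c <> d -> near c (fun z => z <> d).
Proof.
  intros H. exists (Cmod (c - d)). split.
  - apply Cmod_gt_0. intros E. apply H. replace c with ((c - d) + d)%C by ring.
    rewrite E. ring.
  - intros z Hz ->. unfold Defs.disc in Hz. rewrite Cmod_minus_sym in Hz. lra.
Qed.

(** * Analytic functions *)

Lemma analytic_ext (F G : C -> C) (c : C) :
  near c (fun z => F z = G z) -> analytic_at F c -> analytic_at G c.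
Proof.
  intros (r & Hr & H) (a & s & Hs & HF). exists a, (Rmin r s).
  split; [now apply Rmin_glb_lt|]. intros z Hz. unfold Defs.disc in *.
  rewrite <- H; [apply HF|]; (eapply Rlt_le_trans; [exact Hz|]);
    [apply Rmin_r|apply Rmin_l].
Qed.

Lemma quotients_weaken F c E A rho r rho' r' :
  quotients F c E A rho r -> rho <= rho' -> 0 < r' <= r ->
  quotients F c E A rho' r'.
Proof.
  intros HE Hrho Hr'. pose proof (quotients_bound_pos _ _ _ _ _ _ HE) as HA.
  destruct HE as (H1 & H2 & H). split; [lra|]. split; [lra|].
  intros h Hh. destruct (H h ltac:(lra)) as [H0 HN]. split; [exact H0|].
  intros N. destruct (HN N) as [HN1 HN2]. split; [exact HN1|].
  eapply Rle_trans; [exact HN2|]. apply Rmult_le_compat_l; [exact HA|].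
  apply pow_incr. lra.
Qed.

Lemma analytic_const (k c : C) : analytic_at (fun _ => k) c.
Proof.
  apply (analytic_of_quotients _ _ (fun N _ => match N with O => k | _ => 0 end)
           (Cmod k) 1 1).
  split; [lra|]. split; [lra|]. intros h _. split; [reflexivity|].
  intros N. rewrite pow1, Rmult_1_r. destruct N as [|N]; split; try ring; try lra.
  rewrite Cmod_0. apply Cmod_ge_0.
Qed.

Lemma analytic_id (c : C) : analytic_at (fun z => z) c.
Proof.
  apply (analytic_of_quotients _ _
    (fun N h => match N with O => (c + h)%C | S O => 1 | _ => 0 end)
    (Cmod c + 1) 1 1).
  split; [lra|]. split; [lra|]. intros h Hh. split; [reflexivity|].
  intros N. rewrite pow1, Rmult_1_r. pose proof (Cmod_ge_0 c).
  destruct N as [|[|N]]; split; try ring.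
  - eapply Rle_trans; [apply Cmod_triangle|]. lra.
  - rewrite Cmod_1. lra.
  - rewrite Cmod_0. lra.
Qed.

Lemma analytic_quotients_pair F G c :
  analytic_at F c -> analytic_at G c ->
  exists E1 E2 A B rho r, quotients F c E1 A rho r /\ quotients G c E2 B rho r.
Proof.
  intros HF HG.
  destruct (quotients_of_analytic _ _ HF) as (E1 & A & rho1 & r1 & H1).
  destruct (quotients_of_analytic _ _ HG) as (E2 & B & rho2 & r2 & H2).
  exists E1, E2, A, B, (Rmax rho1 rho2), (Rmin r1 r2).
  assert (0 < Rmin r1 r2) by (apply Rmin_glb_lt; [apply H1|apply H2]).
  split; (eapply quotients_weaken; [eassumption| |split]);
    try assumption; auto using Rmax_l, Rmax_r, Rmin_l, Rmin_r.
Qed.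

Lemma analytic_plus F G c :
  analytic_at F c -> analytic_at G c -> analytic_at (fun z => (F z + G z)%C) c.
Proof.
  intros HF HG.
  destruct (analytic_quotients_pair _ _ _ HF HG)
    as (E1 & E2 & A & B & rho & r & (Hrho & Hr & H1) & (_ & _ & H2)).
  apply (analytic_of_quotients _ _ (fun N h => (E1 N h + E2 N h)%C) (A + B) rho r).
  split; [exact Hrho|]. split; [exact Hr|]. intros h Hh.
  destruct (H1 h Hh) as [H10 H1N]. destruct (H2 h Hh) as [H20 H2N].
  split; [now rewrite H10, H20|]. intros N.
  destruct (H1N N) as [H1a H1b]. destruct (H2N N) as [H2a H2b]. split.
  - rewrite H1a, H2a at 1. ring.
  - eapply Rle_trans; [apply Cmod_triangle|]. lra.
Qed.

(** This is the sum of [a_i G_(N-i)] over [i < m]. The product rule for iterated quotients gives, as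
    the [N]-th quotient of [F G], the term [E1_N E2_0] plus this sum for [m = N], the quotients of
    [F] being frozen at the centre. *)
Fixpoint conv (a : nat -> C) (G : nat -> C -> C) (N m : nat) (h : C) : C :=
  match m with
  | O => 0
  | S i => (conv a G N i h + a i * G (N - i)%nat h)%C
  end.

Lemma conv_quotient a (G : nat -> C -> C) (h : C) N m :
  (forall j, G j h = (G j 0 + h * G (S j) h)%C) -> (m <= N)%nat ->
  conv a G N m h = (conv a G N m 0 + h * conv a G (S N) m h)%C.
Proof.
  intros HG. induction m as [|m IH]; intros Hm; cbn [conv]; [ring|].
  rewrite IH by lia. rewrite (HG (N - m)%nat) at 1.
  replace (S N - m)%nat with (S (N - m)) by lia. ring.
Qed.

Lemma conv_bound a (G : nat -> C -> C) A B rho (h : C) N m :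
  0 <= A -> 0 < rho -> (forall i, Cmod (a i) <= A * rho ^ i) ->
  (forall j, Cmod (G j h) <= B * rho ^ j) -> (m <= N)%nat ->
  Cmod (conv a G N m h) <= INR m * (A * B * rho ^ N).
Proof.
  intros HA Hrho Ha HG. induction m as [|m IH]; intros Hm; cbn [conv].
  - rewrite Cmod_0. simpl. lra.
  - eapply Rle_trans; [apply Cmod_triangle|].
    rewrite S_INR, Cmod_mult. specialize (IH ltac:(lia)).
    enough (Cmod (a m) * Cmod (G (N - m)%nat h) <= A * B * rho ^ N) by lra.
    apply Rle_trans with (A * rho ^ m * (B * rho ^ (N - m))).
    + apply Rmult_le_compat; auto using Cmod_ge_0.
    + right. replace N with (m + (N - m))%nat at 2 by lia. rewrite pow_add. ring.
Qed.

Lemma INR_succ_le_pow2 N : INR N + 1 <= 2 ^ N.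
Proof.
  induction N as [|N IH]; [simpl; lra|]. rewrite S_INR. simpl.
  pose proof (pos_INR N). lra.
Qed.

Lemma analytic_mult F G c :
  analytic_at F c -> analytic_at G c -> analytic_at (fun z => (F z * G z)%C) c.
Proof.
  intros HF HG.
  destruct (analytic_quotients_pair _ _ _ HF HG)
    as (E1 & E2 & A & B & rho & r & HE1 & HE2).
  pose proof (quotients_bound_pos _ _ _ _ _ _ HE1) as HA.
  pose proof (quotients_bound_pos _ _ _ _ _ _ HE2) as HB.
  destruct HE1 as (Hrho & Hr & H1). destruct HE2 as (_ & _ & H2).
  (* The [N + 1] terms are each at most [A B rho^N]; doubling the rate to [2 rho] absorbs the factor
     [N + 1 <= 2^N]. *)
  apply (analytic_of_quotients _ _
    (fun N h => (E1 N h * E2 O h + conv (fun i => E1 i 0) E2 N N h)%C) (A * B) (2 * rho) r).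
  split; [lra|]. split; [exact Hr|]. intros h Hh.
  destruct (H1 h Hh) as [H10 H1N]. destruct (H2 h Hh) as [H20 H2N].
  split; [rewrite <- H10, <- H20; simpl; ring|]. intros N. split.
  - rewrite (conv_quotient _ _ h N N) by (auto; intros j; apply H2N).
    cbn [conv]. rewrite Nat.sub_succ_l, Nat.sub_diag by lia.
    rewrite (proj1 (H1N N)) at 1. rewrite (proj1 (H2N 0%nat)). ring.
  - eapply Rle_trans; [apply Cmod_triangle|].
    pose proof (conv_bound (fun i => E1 i 0) E2 A B rho h N N HA Hrho
      ltac:(intros i; apply (proj2 (H1 0%C ltac:(rewrite Cmod_0; exact Hr))))
      ltac:(intros j; apply H2N) (le_n N)) as Hc.
    assert (H3 : Cmod (E1 N h * E2 0%nat h) <= A * B * rho ^ N).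
    { rewrite Cmod_mult. apply Rle_trans with (A * rho ^ N * (B * rho ^ 0)).
      - apply Rmult_le_compat; try apply Cmod_ge_0; [apply H1N|apply H2N].
      - right. simpl. ring. }
    apply Rle_trans with ((INR N + 1) * (A * B * rho ^ N)); [lra|].
    rewrite Rpow_mult_distr.
    replace (A * B * (2 ^ N * rho ^ N)) with (2 ^ N * (A * B * rho ^ N)) by ring.
    apply Rmult_le_compat_r; [|apply INR_succ_le_pow2].
    apply Rmult_le_pos; [now apply Rmult_le_pos|]. apply pow_le. lra.
Qed.

Lemma analytic_cont F c : analytic_at F c ->
  forall eps, 0 < eps -> near c (fun z => Cmod (F z - F c) < eps).
Proof.
  intros HF eps He.
  destruct (quotients_of_analytic _ _ HF) as (E & A & rho & r & HE).
  pose proof (quotients_bound_pos _ _ _ _ _ _ HE) as HA.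
  destruct HE as (Hrho & Hr & H).
  assert (Hd : 0 < A * rho + 1) by (pose proof (Rmult_le_pos A rho); lra).
  exists (Rmin r (eps / (A * rho + 1))). split.
  { apply Rmin_glb_lt; [exact Hr|]. now apply Rdiv_lt_0_compat. }
  intros z Hz. unfold Defs.disc in Hz.
  set (h := (z - c)%C) in *. replace z with (c + h)%C by (unfold h; ring).
  assert (Hh : Cmod h < r) by (eapply Rlt_le_trans; [exact Hz|apply Rmin_l]).
  assert (Hh' : Cmod h < eps / (A * rho + 1))
    by (eapply Rlt_le_trans; [exact Hz|apply Rmin_r]).
  destruct (H h Hh) as [H0 HN].
  destruct (H 0%C ltac:(rewrite Cmod_0; exact Hr)) as [Hc0 _].
  replace (F c) with (E 0%nat 0) by (rewrite Hc0; f_equal; ring).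
  rewrite <- H0, (proj1 (HN 0%nat)).
  replace (E 0%nat 0 + h * E 1%nat h - E 0%nat 0)%C with (h * E 1%nat h)%C by ring.
  rewrite Cmod_mult. pose proof (proj2 (HN 1%nat)) as H1. rewrite pow_1 in H1.
  apply (Rmult_lt_compat_r (A * rho + 1)) in Hh'; [|exact Hd].
  unfold Rdiv in Hh'. rewrite Rmult_assoc, Rinv_l in Hh' by lra.
  pose proof (Cmod_ge_0 h). nra.
Qed.

Lemma analytic_near_nonzero F c :
  analytic_at F c -> F c <> 0 -> near c (fun z => F z <> 0).
Proof.
  intros HF H0. apply Cmod_gt_0 in H0.
  refine (near_imp _ _ _ _ (analytic_cont F c HF _ H0)).
  intros z Hz E. rewrite E in Hz.
  replace (0 - F c)%C with (- F c)%C in Hz by ring. rewrite Cmod_opp in Hz. lra.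
Qed.

(** [inv_quotient G N j] is the [j]-th quotient of the [N]-th remainder in the
    long division of [1] by the power series [G]. *)
Fixpoint inv_quotient (G : nat -> C -> C) (N j : nat) (h : C) : C :=
  match N with
  | O => match j with O => 1 | _ => 0 end
  | S N => (inv_quotient G N (S j) h - inv_quotient G N 0 0 / G 0%nat 0 * G (S j) h)%C
  end.

Lemma inv_quotient_step (G : nat -> C -> C) (h : C) N j :
  (forall j, G j h = (G j 0 + h * G (S j) h)%C) ->
  inv_quotient G N j h = (inv_quotient G N j 0 + h * inv_quotient G N (S j) h)%C.
Proof.
  intros HG. revert j. induction N as [|N IH]; intros j; cbn [inv_quotient].
  - destruct j; ring.
  - rewrite (IH (S j)). rewrite (HG (S j)) at 1. unfold Cdiv. ring.
Qed.

(** A division step shifts the index, which costs a factor [rho], and subtracts a multiple of [G]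
    whose coefficient is the previous bound over [|G 0 0|]. Together they cost
    [rho (1 + B / |G 0 0|)] per step. *)
Lemma inv_quotient_bound (G : nat -> C -> C) B rho (h : C) N j :
  0 < rho -> G 0%nat 0 <> 0 -> 0 <= B ->
  (forall j, Cmod (G j h) <= B * rho ^ j) -> (forall j, Cmod (G j 0) <= B * rho ^ j) ->
  Cmod (inv_quotient G N j h) <= (rho * (1 + B / Cmod (G 0%nat 0))) ^ N * rho ^ j.
Proof.
  intros Hrho H0 HB HG HG0. pose proof (proj1 (Cmod_gt_0 _) H0) as H0'.
  set (b := Cmod (G 0%nat 0)) in *.
  enough (Hgen : forall N j, Cmod (inv_quotient G N j h) <= (rho * (1 + B / b)) ^ N * rho ^ j
      /\ Cmod (inv_quotient G N j 0) <= (rho * (1 + B / b)) ^ N * rho ^ j) by apply Hgen.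
  assert (Hs : 0 <= rho * (1 + B / b)).
  { apply Rmult_le_pos; [lra|]. assert (0 <= B / b); [|lra].
    apply Rmult_le_pos; [exact HB|]. left. now apply Rinv_0_lt_compat. }
  clear N j. induction N as [|N IH]; intros j.
  - simpl. assert (0 < rho ^ j) by now apply pow_lt.
    destruct j; [rewrite Cmod_1; simpl; lra|rewrite Cmod_0; lra].
  - assert (Hstep : forall k, Cmod (G (S j) k) <= B * rho ^ S j ->
       Cmod (inv_quotient G N (S j) k) <= (rho * (1 + B / b)) ^ N * rho ^ S j ->
       Cmod (inv_quotient G (S N) j k) <= (rho * (1 + B / b)) ^ S N * rho ^ j).
    { intros k Hk1 Hk2. cbn [inv_quotient].
      eapply Rle_trans; [apply Cmod_minus_le|].
      rewrite Cmod_mult, Cmod_div by exact H0. fold b.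
      destruct (IH 0%nat) as [_ HI]. rewrite pow_O, Rmult_1_r in HI.
      assert (Hm : Cmod (inv_quotient G N 0 0) / b * Cmod (G (S j) k)
                   <= (rho * (1 + B / b)) ^ N / b * (B * rho ^ S j)).
      { apply Rmult_le_compat; [|apply Cmod_ge_0| |exact Hk1].
        - apply Rmult_le_pos; [apply Cmod_ge_0|]. left. now apply Rinv_0_lt_compat.
        - apply Rmult_le_compat_r; [|exact HI]. left. now apply Rinv_0_lt_compat. }
      eapply Rle_trans; [apply Rplus_le_compat; [exact Hk2|exact Hm]|].
      right. simpl. field. lra. }
    split; apply Hstep; auto; apply IH.
Qed.

Lemma analytic_inv F c : analytic_at F c -> F c <> 0 -> analytic_at (fun z => (/ F z)%C) c.
Proof.
  intros HF Hc.
  destruct (analytic_cont _ _ HF (Cmod (F c) / 2)) as (s & Hs & Hb).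
  { apply Cmod_gt_0 in Hc. lra. }
  destruct (quotients_of_analytic _ _ HF) as (E & A & rho & r & HE).
  apply (quotients_weaken _ _ _ _ _ _ rho (Rmin r s)) in HE; [|lra|split].
  2:{ apply Rmin_glb_lt; [apply HE|exact Hs]. }
  2:{ apply Rmin_l. }
  pose proof (quotients_bound_pos _ _ _ _ _ _ HE) as HA.
  destruct HE as (Hrho & Hr & H).
  destruct (H 0%C ltac:(rewrite Cmod_0; exact Hr)) as [Hc0 HN0].
  replace (c + 0)%C with c in Hc0 by ring.
  (* Long division reads [1 = (polynomial) F + h^N R_N]; dividing by [F] shows that the [N]-th
     quotient of [1 / F] is [R_N / F]. The disc was shrunk so that [|F| >= |F c| / 2] on it, which
     gives the constant [2 / |F c|]. *)
  apply (analytic_of_quotients _ _ (fun N h => (inv_quotient E N 0 h * / F (c + h))%C)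
    (2 / Cmod (F c)) (rho * (1 + A / Cmod (F c))) (Rmin r s)).
  pose proof (proj1 (Cmod_gt_0 _) Hc) as Hc'.
  split.
  { apply Rmult_lt_0_compat; [exact Hrho|]. assert (0 <= A / Cmod (F c)); [|lra].
    apply Rmult_le_pos; [exact HA|]. left. now apply Rinv_0_lt_compat. }
  split; [exact Hr|]. intros h Hh. destruct (H h Hh) as [H0 HN].
  assert (Hlow : Cmod (F c) / 2 <= Cmod (F (c + h)%C)).
  { assert (Hd : Cmod (F (c + h)%C - F c) < Cmod (F c) / 2).
    { apply Hb. unfold Defs.disc. replace (c + h - c)%C with h by ring.
      eapply Rlt_le_trans; [exact Hh|apply Rmin_r]. }
    rewrite Cmod_minus_sym in Hd.
    generalize (Cmod_le_minus (F c) (F (c + h)%C)). lra. }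
  assert (Hnz : F (c + h)%C <> 0) by (apply Cmod_gt_0; lra).
  split; [simpl; ring|]. intros N. split.
  - rewrite (inv_quotient_step E h N 0) by (intros j; apply HN).
    cbn [inv_quotient]. replace (c + 0)%C with c by ring.
    rewrite Hc0. rewrite <- H0, (proj1 (HN 0%nat)), Hc0. field.
    rewrite <- Hc0, <- (proj1 (HN 0%nat)), H0, Hc0. auto.
  - rewrite Cmod_mult, Cmod_inv by exact Hnz.
    pose proof (inv_quotient_bound E A rho h N 0 Hrho ltac:(rewrite Hc0; exact Hc) HA
      ltac:(intros j; apply HN) ltac:(intros j; apply HN0)) as Hq.
    rewrite Hc0, pow_O, Rmult_1_r in Hq. rewrite (Rmult_comm (2 / _)).
    apply Rmult_le_compat; [apply Cmod_ge_0| |exact Hq|].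
    + left. apply Rinv_0_lt_compat. lra.
    + replace (2 / Cmod (F c)) with (/ (Cmod (F c) / 2)) by (field; lra).
      apply Rinv_le_contravar; lra.
Qed.

Lemma analytic_opp F c : analytic_at F c -> analytic_at (fun z => (- F z)%C) c.
Proof.
  intros HF. apply analytic_ext with (fun z => (-(1) * F z)%C).
  - apply near_all. intros z. ring.
  - apply analytic_mult; [apply analytic_const|exact HF].
Qed.

Lemma analytic_minus F G c :
  analytic_at F c -> analytic_at G c -> analytic_at (fun z => (F z - G z)%C) c.
Proof. intros HF HG. apply analytic_plus; [exact HF|]. now apply analytic_opp. Qed.

Lemma analytic_div F G c :
  analytic_at F c -> analytic_at G c -> G c <> 0 -> analytic_at (fun z => (F z / G z)%C) c.
Proof. intros HF HG H0. apply analytic_mult; [exact HF|]. now apply analytic_inv. Qed.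

Lemma analytic_pow F c m : analytic_at F c -> analytic_at (fun z => Cpow (F z) m) c.
Proof.
  intros HF. induction m as [|m IH]; simpl; [apply analytic_const|].
  now apply analytic_mult.
Qed.

Lemma analytic_quotient F c : analytic_at F c ->
  exists G, analytic_at G c /\ near c (fun z => F z = (F c + (z - c) * G z)%C).
Proof.
  intros HF. destruct (quotients_of_analytic _ _ HF) as (E & A & rho & r & Hrho & Hr & H).
  exists (fun z => E 1%nat (z - c)%C). split.
  - apply (analytic_of_quotients _ _ (fun N => E (S N)) (A * rho) rho r).
    split; [exact Hrho|]. split; [exact Hr|]. intros h Hh.
    destruct (H h Hh) as [H0 HN]. split; [f_equal; ring|].
    intros N. rewrite Rmult_assoc. exact (HN (S N)).
  - exists r. split; [exact Hr|]. intros z Hz. unfold Defs.disc in Hz.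
    destruct (H _ Hz) as [H0 HN]. destruct (H 0%C ltac:(rewrite Cmod_0; exact Hr)) as [Hc _].
    replace (c + (z - c))%C with z in H0 by ring. replace (c + 0)%C with c in Hc by ring.
    now rewrite <- H0, <- Hc, <- (proj1 (HN 0%nat)).
Qed.

(** [analytic_at] is a power series at one point; asking for one at each point of a disc avoids
    re-expanding about neighbouring points. *)
Definition analytic_near (F : C -> C) (c : C) : Prop := near c (analytic_at F).

(** [G] is the difference quotient itself, so the factorisation holds at every [z] and analyticity
    off [c] is that of a quotient; the local factor is used at [c] alone. *)
Lemma analytic_near_factor F c : analytic_near F c ->
  exists G, analytic_near G c /\ forall z, F z = (F c + (z - c) * G z)%C.
Proof.
  intros HF. destruct (analytic_quotient F c (near_point _ _ HF)) as (G & HG & Hn).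
  exists (fun z => if Ceq_dec z c then G c else ((F z - F c) / (z - c))%C).
  split.
  - refine (near_imp2 _ _ _ _ _ HF (near_near _ _ Hn)). intros z Hz Hnz.
    destruct (Ceq_dec z c) as [->|Hne].
    + apply analytic_ext with G; [|exact HG]. refine (near_imp _ _ _ _ Hn).
      intros u Hu. destruct (Ceq_dec u c) as [->|Huc]; [reflexivity|].
      rewrite Hu. field. intros E. apply Huc. replace u with ((u - c) + c)%C by ring.
      rewrite E. ring.
    + apply analytic_ext with (fun u => ((F u - F c) / (u - c))%C).
      * refine (near_imp _ _ _ _ (near_ne _ _ Hne)). intros u Hu.
        now destruct (Ceq_dec u c).
      * apply analytic_div.
        -- apply analytic_minus; [exact Hz|apply analytic_const].
        -- apply analytic_minus; [apply analytic_id|apply analytic_const].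
        -- intros E. apply Hne. replace z with ((z - c) + c)%C by ring. rewrite E. ring.
  - intros z. destruct (Ceq_dec z c) as [->|Hne]; [ring|]. field.
    intros E. apply Hne. replace z with ((z - c) + c)%C by ring. rewrite E. ring.
Qed.

(** If all Taylor coefficients [E m 0] vanish, then [F = h^k E k h] for every [k], and this tends to
    [0]. Otherwise the quotient [E m] at the least [m] with [E m 0 <> 0] is the cofactor. *)
Lemma analytic_order F c : analytic_at F c ->
  near c (fun z => F z = 0) \/
  exists m G, analytic_at G c /\ G c <> 0 /\
    near c (fun z => F z = (Cpow (z - c) m * G z)%C).
Proof.
  intros HF. destruct (quotients_of_analytic _ _ HF) as (E & A & rho & r & HE).
  pose proof HE as (Hrho & Hr & H).
  destruct (Classical_Prop.classic (exists m, E m 0 <> 0)) as [Hex|Hall].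
  - right.
    destruct (Wf_nat.dec_inh_nat_subset_has_unique_least_element
      (fun m => E m 0 <> 0)) as (m & [Hm Hmin] & _).
    { intros k. apply Classical_Prop.classic. }
    { exact Hex. }
    assert (Hlt : forall k, (k < m)%nat -> E k 0 = 0).
    { intros k Hk. apply Classical_Prop.NNPP. intros Hk0. specialize (Hmin k Hk0). lia. }
    exists m, (fun z => E m (z - c)%C). split; [|split].
    + apply (analytic_of_quotients _ _ (fun N => E (m + N)%nat) (A * rho ^ m) rho r).
      split; [exact Hrho|]. split; [exact Hr|]. intros h Hh.
      destruct (H h Hh) as [H0 HN].
      split; [rewrite Nat.add_0_r; f_equal; ring|]. intros N.
      rewrite Rmult_assoc, <- pow_add, Nat.add_succ_r. exact (HN (m + N)%nat).
    + replace (c - c)%C with (RtoC 0) by ring. exact Hm.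
    + exists r. split; [exact Hr|]. intros z Hz. unfold Defs.disc in Hz.
      set (h := (z - c)%C) in *. destruct (H h Hz) as [H0 HN].
      replace (c + h)%C with z in H0 by (unfold h; ring). rewrite <- H0.
      clear Hm Hmin. induction m as [|m IH]; [simpl; ring|].
      rewrite IH by (intros; apply Hlt; lia). rewrite (proj1 (HN m)), Hlt by lia.
      simpl. ring.
  - left. exists (Rmin r (1 / (2 * rho))).
    assert (Hr' : 0 < 1 / (2 * rho)) by (apply Rdiv_lt_0_compat; lra).
    split; [now apply Rmin_glb_lt|].
    intros z Hz. unfold Defs.disc in Hz. set (h := (z - c)%C) in *.
    assert (Hz1 : Cmod h < r) by (eapply Rlt_le_trans; [exact Hz|apply Rmin_l]).
    assert (Hz2 : Cmod h * rho <= 1 / 2).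
    { apply Rle_trans with (1 / (2 * rho) * rho).
      - apply Rmult_le_compat_r; [lra|]. left.
        eapply Rlt_le_trans; [exact Hz|apply Rmin_r].
      - right. field. lra. }
    destruct (H h Hz1) as [H0 HN].
    replace (c + h)%C with z in H0 by (unfold h; ring).
    assert (Hk : forall k, F z = (Cpow h k * E k h)%C).
    { induction k as [|k IH]; [rewrite H0; simpl; ring|].
      rewrite IH, (proj1 (HN k)).
      replace (E k 0) with (RtoC 0); [simpl; ring|].
      symmetry. apply Classical_Prop.NNPP. intros Hn. apply Hall. now exists k. }
    apply Cmod_eq_0. apply Rle_antisym; [|apply Cmod_ge_0]. apply Rnot_lt_le. intros Hpos.
    destruct (geometric_small A _ (quotients_bound_pos _ _ _ _ _ _ HE) Hpos) as [N HN'].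
    specialize (HN' N (le_n N)). pose proof (quotients_remainder _ _ _ _ _ _ h N HE Hz1 Hz2) as Hrem.
    rewrite <- Hk in Hrem. lra.
Qed.

(** * Minimum principles in the half-plane *)

Lemma Cmod_le_Re_Im (z : C) : Cmod z <= Rabs (Re z) + Rabs (Im z).
Proof.
  replace z with (RtoC (Re z) + Ci * RtoC (Im z))%C at 1.
  - eapply Rle_trans; [apply Cmod_triangle|].
    rewrite Cmod_mult, Cmod_Ci, !Cmod_R. lra.
  - destruct z as [a b]. unfold Cplus, Cmult, Ci, RtoC, Re, Im. simpl. f_equal; ring.
Qed.

Lemma sum_squares_pos (a b : R) : 0 < b -> 0 < a ^ 2 + b ^ 2.
Proof. intros Hb. nra. Qed.

Lemma Im_tau (t x : R) (z : C) : 0 < t -> upper_half_plane z ->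
  Im (1 / (RtoC t * (z - RtoC x)))%C = - (Im z / (t * ((Re z - x) ^ 2 + Im z ^ 2))).
Proof.
  unfold upper_half_plane. intros Ht Hz. destruct z as [a b]. simpl in *.
  unfold Cdiv, Cmult, Cinv, RtoC, Im, Re. simpl. field.
  pose proof (sum_squares_pos (a - x) b Hz) as H. simpl in H. rewrite !Rmult_1_r in H.
  split; [apply Rgt_not_eq; lra|]. split; [apply Rgt_not_eq; lra|].
  replace (t * (a + - x) * (t * (a + - x)) + t * b * (t * b))
    with (t * t * ((a - x) * (a - x) + b * b)) by ring.
  apply Rgt_not_eq. repeat apply Rmult_lt_0_compat; lra.
Qed.

(** Averaging over [c + rho i^k] for [k = 0, .., 3] annihilates the Taylor terms of
    degrees 1 and 2, so [Im g - eps |z - p|^2] is strictly superharmonic up to [O(rho^3)]. *)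
Lemma analytic_no_local_min (g : C -> C) (c p : C) (eps : R) :
  analytic_at g c -> 0 < eps ->
  ~ near c (fun z => Im (g c) - eps * (Re (c - p) ^ 2 + Im (c - p) ^ 2)
                     <= Im (g z) - eps * (Re (z - p) ^ 2 + Im (z - p) ^ 2)).
Proof.
  intros Hg He (s & Hs & Hmin).
  destruct (quotients_of_analytic _ _ Hg) as (E & A & rho & r & HE).
  pose proof (quotients_bound_pos _ _ _ _ _ _ HE) as HA.
  pose proof HE as (Hrho & Hr & H).
  set (M := A * rho ^ 3 + 1).
  assert (HM : 0 < M).
  { unfold M. pose proof (pow_lt rho 3 Hrho). nra. }
  (* On the circle of radius [q] the penalty gains [eps q^2] on average, and [q M < eps] makes this
     exceed the cubic error [M q^3]. *)
  set (q := Rmin (Rmin (r / 2) (s / 2)) (eps / (2 * M))).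
  assert (Hq : 0 < q).
  { repeat apply Rmin_glb_lt; try lra. apply Rdiv_lt_0_compat; lra. }
  assert (Hqr : q < r).
  { generalize (Rmin_l (Rmin (r / 2) (s / 2)) (eps / (2 * M))) (Rmin_l (r / 2) (s / 2)).
    fold q. lra. }
  assert (Hqs : q < s).
  { generalize (Rmin_l (Rmin (r / 2) (s / 2)) (eps / (2 * M))) (Rmin_r (r / 2) (s / 2)).
    fold q. lra. }
  assert (HqM : q * M < eps).
  { assert (Hle : q <= eps / (2 * M)) by apply Rmin_r.
    apply (Rmult_le_compat_r M) in Hle; [|lra].
    replace (eps / (2 * M) * M) with (eps / 2) in Hle by (field; lra). lra. }
  assert (Hh : forall h, Cmod h = q ->
    Im (g c) - eps * (Re (c - p) ^ 2 + Im (c - p) ^ 2) <=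
    Im (g c + h * E 1%nat 0 + h * h * E 2%nat 0)%C + M * q ^ 3 -
      eps * (Re (c + h - p) ^ 2 + Im (c + h - p) ^ 2)).
  { intros h Hh.
    assert (Hd : Defs.disc c s (c + h)%C).
    { unfold Defs.disc. replace (c + h - c)%C with h by ring. lra. }
    specialize (Hmin _ Hd). eapply Rle_trans; [exact Hmin|].
    apply Rplus_le_compat_r.
    destruct (H h ltac:(lra)) as [H0 HN].
    assert (Hc0 : E 0%nat 0 = g c).
    { destruct (H 0%C ltac:(rewrite Cmod_0; exact Hr)) as [Hc _]. rewrite Hc. f_equal. ring. }
    rewrite <- H0, (proj1 (HN 0%nat)), (proj1 (HN 1%nat)), (proj1 (HN 2%nat)), Hc0.
    replace (g c + h * (E 1%nat 0 + h * (E 2%nat 0 + h * E 3%nat h)))%C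
      with ((g c + h * E 1%nat 0 + h * h * E 2%nat 0) + Cpow h 3 * E 3%nat h)%C
      by (simpl; ring).
    unfold Im at 1. simpl snd at 1. fold (Im (g c + h * E 1%nat 0 + h * h * E 2%nat 0)%C).
    apply Rplus_le_compat_l.
    eapply Rle_trans; [apply Rle_abs|].
    eapply Rle_trans; [apply (im_le_Cmod (Cpow h 3 * E 3%nat h)%C)|].
    rewrite Cmod_mult, Cmod_pow, Hh. rewrite Rmult_comm.
    apply Rmult_le_compat_r; [apply pow_le; lra|].
    unfold M. pose proof (proj2 (HN 3%nat)). lra. }
  pose proof (Hh (RtoC q) ltac:(rewrite Cmod_R, Rabs_pos_eq; lra)) as K1.
  pose proof (Hh (- RtoC q)%C ltac:(rewrite Cmod_opp, Cmod_R, Rabs_pos_eq; lra)) as K2.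
  pose proof (Hh (Ci * RtoC q)%C
    ltac:(rewrite Cmod_mult, Cmod_Ci, Cmod_R, Rabs_pos_eq; lra)) as K3.
  pose proof (Hh (- (Ci * RtoC q))%C
    ltac:(rewrite Cmod_opp, Cmod_mult, Cmod_Ci, Cmod_R, Rabs_pos_eq; lra)) as K4.
  clear Hh Hmin. destruct (g c) as [g1 g2], (E 1%nat 0) as [a1 a2], (E 2%nat 0) as [b1 b2],
    c as [c1 c2], p as [p1 p2].
  unfold Cplus, Cminus, Cmult, Copp, Ci, RtoC, Re, Im in K1, K2, K3, K4. simpl in K1, K2, K3, K4.
  assert (Hq2 : 0 < q * q) by now apply Rmult_lt_0_compat.
  assert (Hc : q * M * (q * q) < eps * (q * q)) by now apply Rmult_lt_compat_r.
  lra.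
Qed.

(** The one-variable extreme value theorem is applied twice: to each fibre, with a chosen minimiser
    [Y x], and then to [u x (Y x)]. The latter is continuous because the minimisers of two nearby
    fibres can be tested against each other. *)
Lemma min_on_rectangle (u : R -> R -> R) (a b c d : R) :
  a <= b -> c <= d -> (forall x y, c <= y <= d -> continuity_2d_pt u x y) ->
  exists x0 y0, a <= x0 <= b /\ c <= y0 <= d /\
    forall x y, a <= x <= b -> c <= y <= d -> u x0 y0 <= u x y.
Proof.
  intros Hab Hcd Hu.
  assert (Hy : forall x, exists y, c <= y <= d /\ forall y', c <= y' <= d -> u x y <= u x y').
  { intros x. destruct (continuity_ab_min (u x) c d Hcd) as (y & Hmin & Hin).
    - intros y Hyin. apply continuity_pt_locally. intros eps.
      destruct (Hu x y Hyin eps) as [del Hdel]. exists del. intros v Hv.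
      apply Hdel; [rewrite Rminus_diag, Rabs_R0; apply cond_pos|exact Hv].
    - exists y. auto. }
  set (Y := fun x => proj1_sig (ClassicalEpsilon.constructive_indefinite_description _ (Hy x))).
  assert (HY : forall x, c <= Y x <= d /\ forall y', c <= y' <= d -> u x (Y x) <= u x y').
  { intros x. unfold Y. now destruct ClassicalEpsilon.constructive_indefinite_description. }
  destruct (continuity_ab_min (fun x => u x (Y x)) a b Hab) as (x0 & Hmin & Hin).
  - intros x Hx. apply continuity_pt_locally. intros eps.
    (* Continuity is two-sided at [a] and [b] as well, so the rectangle is widened by [1] and the
       modulus capped at [1]. *)
    destruct (uniform_continuity_2d u (a - 1) (b + 1) c d) with (eps := eps) as [del Hdel].
    { intros x' y' _ Hy'. now apply Hu. }
    assert (Hm : 0 < Rmin del 1) by (apply Rmin_glb_lt; [apply cond_pos|lra]).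
    exists (mkposreal _ Hm). intros x' Hx'. unfold ball in Hx'. simpl in Hx'.
    unfold AbsRing_ball, abs, minus, plus, opp in Hx'. simpl in Hx'.
    assert (Hx1 : Rabs (x' - x) < del) by (eapply Rlt_le_trans; [exact Hx'|apply Rmin_l]).
    assert (Hx2 : Rabs (x' - x) < 1) by (eapply Rlt_le_trans; [exact Hx'|apply Rmin_r]).
    apply Rabs_def2 in Hx2.
    destruct (HY x) as [HYx1 HYx2]. destruct (HY x') as [HYx1' HYx2'].
    pose proof (Hdel x (Y x) x' (Y x) ltac:(lra) HYx1 ltac:(lra) HYx1 Hx1
      ltac:(rewrite Rminus_diag, Rabs_R0; apply cond_pos)) as D1.
    pose proof (Hdel x (Y x') x' (Y x') ltac:(lra) HYx1' ltac:(lra) HYx1' Hx1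
      ltac:(rewrite Rminus_diag, Rabs_R0; apply cond_pos)) as D2.
    apply Rabs_def2 in D1. apply Rabs_def2 in D2.
    specialize (HYx2 _ HYx1'). specialize (HYx2' _ HYx1).
    apply Rabs_def1; lra.
  - exists x0, (Y x0). split; [exact Hin|]. split; [apply HY|].
    intros x y Hx Hyin. apply Rle_trans with (u x (Y x)); [now apply Hmin|now apply HY].
Qed.

Lemma analytic_near_Im (g : C -> C) (c : C) : analytic_at g c ->
  forall eps, 0 < eps -> near c (fun z => Rabs (Im (g z) - Im (g c)) < eps).
Proof.
  intros Hg eps He. refine (near_imp _ _ _ _ (analytic_cont _ _ Hg eps He)).
  intros z Hz. eapply Rle_lt_trans; [|exact Hz]. exact (im_le_Cmod (g z - g c)%C).
Qed.

Lemma analytic_Im_continuous (g : C -> C) (x y : R) :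
  analytic_at g (x, y) -> continuity_2d_pt (fun a b => Im (g (a, b))) x y.
Proof.
  intros Hg eps.
  destruct (analytic_cont _ _ Hg eps (cond_pos eps)) as (r & Hr & H).
  assert (Hr2 : 0 < r / 2) by lra.
  exists (mkposreal _ Hr2). simpl. intros a b Ha Hb.
  eapply Rle_lt_trans; [|apply (H (a, b))].
  - exact (im_le_Cmod (g (a, b) - g (x, y))%C).
  - unfold Defs.disc. eapply Rle_lt_trans; [apply Cmod_le_Re_Im|].
    unfold Cminus, Re, Im. simpl. fold (a - x) (b - y). lra.
Qed.

Lemma continuity_2d_dist2 (p q x y : R) :
  continuity_2d_pt (fun a b => (a - p) ^ 2 + (b - q) ^ 2) x y.
Proof.
  apply continuity_2d_pt_ext with (fun a b => (a - p) * (a - p) + (b - q) * (b - q)).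
  { intros a b. ring. }
  apply continuity_2d_pt_plus; apply continuity_2d_pt_mult; apply continuity_2d_pt_minus;
    auto using continuity_2d_pt_id1, continuity_2d_pt_id2, continuity_2d_pt_const.
Qed.

(** Julia's lemma.  The imaginary part is bounded below by [Im phi >= 0] minus a term that
    vanishes at infinity and on the real line off [x], and by [G] near [x]; so a negative
    value would force an interior minimum. *)
Lemma Im_remove_pole (phi G : C -> C) (x t : R) :
  0 < t -> Pick_class phi -> analytic_at G (RtoC x) ->
  near (RtoC x) (fun z => upper_half_plane z ->
    G z = (phi z + 1 / (RtoC t * (z - RtoC x)))%C) ->
  forall z, upper_half_plane z -> 0 <= Im (phi z + 1 / (RtoC t * (z - RtoC x)))%C.
Proof.
  intros Ht Hphi HG Hnear.
  set (g := fun z => (phi z + 1 / (RtoC t * (z - RtoC x)))%C) in *.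
  assert (Hg_im : forall z, upper_half_plane z ->
    Im (g z) = Im (phi z) - Im z / (t * ((Re z - x) ^ 2 + Im z ^ 2))).
  { intros z Hz. unfold g. rewrite <- (Rplus_0_r (Im (phi z) - _)).
    change (Im (phi z) + Im (1 / (RtoC t * (z - RtoC x)))%C = Im (phi z) -
      Im z / (t * ((Re z - x) ^ 2 + Im z ^ 2)) + 0). rewrite Im_tau by assumption. ring. }
  assert (Hg_low : forall z, upper_half_plane z ->
    - Im (g z) * (t * ((Re z - x) ^ 2 + Im z ^ 2)) <= Im z).
  { intros z Hz. rewrite Hg_im by exact Hz. unfold upper_half_plane in Hz.
    destruct (Hphi z Hz) as [_ Hp].
    assert (HD : 0 < t * ((Re z - x) ^ 2 + Im z ^ 2)) by (apply Rmult_lt_0_compat; [exact Ht|now apply sum_squares_pos]).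
    replace (- (Im (phi z) - Im z / (t * ((Re z - x) ^ 2 + Im z ^ 2)))
             * (t * ((Re z - x) ^ 2 + Im z ^ 2)))
      with (Im z - Im (phi z) * (t * ((Re z - x) ^ 2 + Im z ^ 2))) by (field; nra).
    nra. }
  assert (HGx : 0 <= Im (G (RtoC x))).
  { apply Rnot_lt_le. intros Hneg. set (del := - Im (G (RtoC x)) / 2).
    assert (Hdel : 0 < del) by (unfold del; lra).
    assert (Hloc : near (RtoC x) (fun z => upper_half_plane z -> Im (g z) < - del)).
    { refine (near_imp2 _ _ _ _ _ (analytic_near_Im _ _ HG del Hdel) Hnear).
      intros z HA HB Hz. specialize (HB Hz). change (G z = g z) in HB. rewrite <- HB.
      apply Rabs_def2 in HA. unfold del in *. lra. }
    destruct Hloc as (r & Hr & H).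
    (* The test point [x + s + i e] lies beside [x], just above the real axis. There [Hg_low] gives
       [Im g >= - e / (t s^2) >= - del], against [Hloc]. *)
    set (s := r / 2). set (e := Rmin (r / 4) (t * del * s ^ 2)).
    assert (He : 0 < e).
    { apply Rmin_glb_lt; [lra|]. unfold s.
      apply Rmult_lt_0_compat; [now apply Rmult_lt_0_compat|]. apply pow_lt. lra. }
    assert (He1 : e <= r / 4) by apply Rmin_l.
    assert (He2 : e <= t * del * s ^ 2) by apply Rmin_r.
    assert (Hz : upper_half_plane (x + s, e)) by exact He.
    specialize (H (x + s, e)). specialize (Hg_low _ Hz).
    assert (Hlt : Im (g (x + s, e)) < - del).
    { apply H; [|exact Hz]. unfold Defs.disc.
      eapply Rle_lt_trans; [apply Cmod_le_Re_Im|]. unfold Cminus, Re, Im. simpl.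
      replace (x + s + - x) with s by ring. replace (e + - 0) with e by ring.
      rewrite !Rabs_pos_eq; unfold s in *; lra. }
    change (- Im (g (x + s, e)) * (t * ((x + s - x) ^ 2 + e ^ 2)) <= e) in Hg_low.
    replace (x + s - x) with s in Hg_low by ring.
    assert (Hpos : 0 < t * (s ^ 2 + e ^ 2)).
    { apply Rmult_lt_0_compat; [exact Ht|]. exact (sum_squares_pos s e He). }
    assert (Hbig : del * (t * (s ^ 2 + e ^ 2)) < e).
    { eapply Rlt_le_trans; [|exact Hg_low]. apply Rmult_lt_compat_r; [exact Hpos|lra]. }
    assert (0 < del * t * (e * e)) by (repeat apply Rmult_lt_0_compat; lra).
    nra. }
  intros z0 Hz0. fold (g z0). apply Rnot_lt_le. intros Hneg.
  set (del := - Im (g z0) / 2). assert (Hdel : 0 < del) by (unfold del; lra).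
  assert (Hloc : near (RtoC x) (fun z => upper_half_plane z -> - del < Im (g z))).
  { refine (near_imp2 _ _ _ _ _ (analytic_near_Im _ _ HG del Hdel) Hnear).
    intros z HA HB Hz. specialize (HB Hz). change (G z = g z) in HB. rewrite <- HB.
    apply Rabs_def2 in HA. lra. }
  destruct Hloc as (rho & Hrho & Hloc).
  assert (Htd : 0 < t * del) by now apply Rmult_lt_0_compat.
  (* [L] and [eta] fence in the set where [Im g <= - del]. By [Hg_low], [t del |z - x|^2 <= Im z] on
     it, so [Im z] and [|Re z - x|] are at most [1 / (t del)]; being at distance at least [rho / 2]
     from [x], its points also have [Im z > eta]. The other terms put [z0] in the rectangle. *)
  set (L := 1 / (t * del) + Rabs (Re z0 - x) + Im z0 + 1).
  set (eta := Rmin (Im z0 / 2) (t * del * (rho / 2) ^ 2 / 2)).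
  unfold upper_half_plane in Hz0.
  assert (Hinv : 0 < 1 / (t * del)) by (apply Rdiv_lt_0_compat; lra).
  assert (HL : 1 / (t * del) < L /\ Rabs (Re z0 - x) < L /\ Im z0 < L /\ 1 <= L).
  { unfold L. pose proof (Rabs_pos (Re z0 - x)). lra. }
  assert (Heta : 0 < eta).
  { apply Rmin_glb_lt; [lra|]. assert (0 < (rho / 2) ^ 2) by (apply pow_lt; lra). nra. }
  assert (Heta1 : eta <= Im z0 / 2) by apply Rmin_l.
  assert (Heta2 : eta < t * del * (rho / 2) ^ 2).
  { assert (0 < (rho / 2) ^ 2) by (apply pow_lt; lra).
    assert (eta <= t * del * (rho / 2) ^ 2 / 2) by apply Rmin_r. nra. }
  assert (Hint : forall z, upper_half_plane z -> Im (g z) <= - del ->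
    x - L < Re z < x + L /\ eta < Im z < L).
  { intros z Hz Hgz. specialize (Hg_low z Hz).
    assert (Hz' : 0 < Im z) by exact Hz.
    assert (Hb : t * del * ((Re z - x) ^ 2 + Im z ^ 2) <= Im z).
    { eapply Rle_trans; [|exact Hg_low].
      replace (t * del * ((Re z - x) ^ 2 + Im z ^ 2))
        with (del * (t * ((Re z - x) ^ 2 + Im z ^ 2))) by ring.
      apply Rmult_le_compat_r; [|lra].
      apply Rmult_le_pos; [lra|]. left. now apply sum_squares_pos. }
    assert (Hfar : rho / 2 <= Rabs (Re z - x) \/ rho / 2 <= Im z).
    { apply Classical_Prop.NNPP. intros Hn. apply Rlt_not_le in Hgz; [exact Hgz|].
      apply Hloc; [|exact Hz]. unfold Defs.disc.
      eapply Rle_lt_trans; [apply Cmod_le_Re_Im|].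
      unfold Cminus, Re, Im in *. simpl. fold (fst z - x).
      replace (snd z + - 0) with (snd z) by ring. rewrite (Rabs_pos_eq (snd z)) by lra.
      apply Classical_Prop.not_or_and in Hn. lra. }
    assert (Hr2 : (rho / 2) ^ 2 <= (Re z - x) ^ 2 + Im z ^ 2).
    { assert (0 <= (Re z - x) ^ 2) by apply pow2_ge_0. assert (0 <= Im z ^ 2) by apply pow2_ge_0.
      destruct Hfar as [Hf|Hf].
      - rewrite <- (pow2_abs (Re z - x)).
        apply Rle_trans with (Rabs (Re z - x) ^ 2); [apply pow_incr; lra|lra].
      - apply Rle_trans with (Im z ^ 2); [apply pow_incr; lra|lra]. }
    assert (Him : Im z <= 1 / (t * del)).
    { apply Rmult_le_reg_l with (t * del * Im z); [now apply Rmult_lt_0_compat|].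
      replace (t * del * Im z * (1 / (t * del))) with (Im z) by (field; lra).
      assert (0 <= t * del * (Re z - x) ^ 2) by (apply Rmult_le_pos; [lra|apply pow2_ge_0]).
      lra. }
    assert (Hre : Rabs (Re z - x) <= 1 / (t * del)).
    { apply Rsqr_incr_0_var; [|lra]. unfold Rsqr.
      rewrite <- Rabs_mult, (Rabs_pos_eq ((Re z - x) * (Re z - x))) by apply Rle_0_sqr.
      apply Rmult_le_reg_l with (t * del); [exact Htd|].
      replace (t * del * (1 / (t * del) * (1 / (t * del)))) with (1 / (t * del)) by (field; lra).
      assert (0 <= t * del * Im z ^ 2) by (apply Rmult_le_pos; [lra|apply pow2_ge_0]). lra. }
    split; [|split]; [| |lra].
    2:{ assert (t * del * (rho / 2) ^ 2 <= t * del * ((Re z - x) ^ 2 + Im z ^ 2))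
          by (apply Rmult_le_compat_l; lra). lra. }
    assert (Hre' : Rabs (Re z - x) < L) by lra. apply Rabs_def2 in Hre'. lra. }
  assert (HLpos : 0 < 2 * L ^ 2) by nra.
  (* The penalty is then at most [del / 2] on the rectangle. As [Im (g z0) = - 2 del], the penalised
     minimiser still has [Im g <= - del], and [Hint] makes it interior. *)
  set (eps := del / 2 / (2 * L ^ 2)).
  assert (Heps : 0 < eps) by (apply Rdiv_lt_0_compat; lra).
  assert (HepsL : eps * (2 * L ^ 2) = del / 2) by (unfold eps; field; lra).
  assert (Hgan : forall z, upper_half_plane z -> analytic_at g z).
  { intros z Hz. apply analytic_plus; [apply Hphi, Hz|].
    apply analytic_div; [apply analytic_const|..].
    - apply analytic_mult; [apply analytic_const|].
      apply analytic_minus; [apply analytic_id|apply analytic_const].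
    - intros E0. apply (f_equal Im) in E0. unfold upper_half_plane in Hz.
      destruct z as [a b]. unfold Im, Cmult, Cminus, RtoC in *. simpl in *. nra. }
  destruct (min_on_rectangle (fun a b => Im (g (a, b)) - eps * ((a - x) ^ 2 + (b - 0) ^ 2))
              (x - L) (x + L) eta L) as (a & b & Ha & Hb & Hmin).
  { lra. }
  { lra. }
  { intros a b Hb. apply continuity_2d_pt_minus.
    - apply analytic_Im_continuous, Hgan. unfold upper_half_plane, Im. simpl. lra.
    - apply continuity_2d_pt_mult; [apply continuity_2d_pt_const|apply continuity_2d_dist2]. }
  assert (Hab : upper_half_plane (a, b)) by (unfold upper_half_plane, Im; simpl; lra).
  destruct HL as (HL1 & HL2 & HL3 & HL4). apply Rabs_def2 in HL2.
  assert (Hin : x - L < a < x + L /\ eta < b < L).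
  { apply (Hint (a, b) Hab).
    pose proof (Hmin (Re z0) (Im z0) ltac:(lra) ltac:(lra)) as H0.
    replace (Re z0, Im z0) with z0 in H0 by (now destruct z0).
    assert (Hsq : (a - x) ^ 2 + (b - 0) ^ 2 <= 2 * L ^ 2).
    { rewrite <- (pow2_abs (a - x)), <- (pow2_abs (b - 0)).
      assert (Rabs (a - x) <= L) by (apply Rabs_le; lra).
      assert (Rabs (b - 0) <= L) by (apply Rabs_le; lra).
      pose proof (pow_incr (Rabs (a - x)) L 2 ltac:(split; [apply Rabs_pos|lra])).
      pose proof (pow_incr (Rabs (b - 0)) L 2 ltac:(split; [apply Rabs_pos|lra])). lra. }
    assert (0 <= eps * ((Re z0 - x) ^ 2 + (Im z0 - 0) ^ 2)).
    { apply Rmult_le_pos; [lra|]. left. apply sum_squares_pos. lra. }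
    assert (eps * ((a - x) ^ 2 + (b - 0) ^ 2) <= eps * (2 * L ^ 2))
      by (apply Rmult_le_compat_l; lra).
    unfold del in *. lra. }
  apply (analytic_no_local_min g (a, b) (RtoC x) eps (Hgan _ Hab) Heps).
  exists (Rmin (Rmin (a - (x - L)) (x + L - a)) (Rmin (b - eta) (L - b))).
  split; [repeat apply Rmin_glb_lt; lra|].
  intros [a' b'] Hd. unfold Defs.disc in Hd.
  assert (Ha' : Rabs (a' - a) <= Cmod ((a', b') - (a, b))%C)
    by exact (re_le_Cmod ((a', b') - (a, b))%C).
  assert (Hb' : Rabs (b' - b) <= Cmod ((a', b') - (a, b))%C)
    by exact (im_le_Cmod ((a', b') - (a, b))%C).
  apply Rmin_Rgt in Hd. destruct Hd as [Hd1 Hd2].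
  apply Rmin_Rgt in Hd1. apply Rmin_Rgt in Hd2.
  assert (Ha'' := Rle_trans _ _ _ (Rle_abs _) Ha').
  assert (Hb'' := Rle_trans _ _ _ (Rle_abs _) Hb').
  assert (Ha3 := Rle_trans _ _ _ (Rle_abs _) (Rle_trans _ _ _ (Req_le _ _ (Rabs_Ropp _)) Ha')).
  assert (Hb3 := Rle_trans _ _ _ (Rle_abs _) (Rle_trans _ _ _ (Req_le _ _ (Rabs_Ropp _)) Hb')).
  exact (Hmin a' b' ltac:(lra) ltac:(lra)).
Qed.

(** * Rigidity of Pick functions taking a real value *)

(** By de Moivre [zeta^m] can be any number of modulus [1], and one of the four quarter turns takes
    [b] into the open lower half-plane. *)
Lemma direction_negative_Im (b : C) (m : nat) : b <> 0 -> (1 <= m)%nat ->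
  exists zeta, Cmod zeta = 1 /\ Im (Cpow zeta m * b)%C < 0.
Proof.
  intros Hb Hm.
  assert (Hmoivre : forall th k, Cpow (cos th, sin th) k = (cos (INR k * th), sin (INR k * th))).
  { intros th k. induction k as [|k IH].
    - simpl. rewrite Rmult_0_l, cos_0, sin_0. reflexivity.
    - rewrite S_INR. simpl. rewrite IH.
      replace ((INR k + 1) * th) with (th + INR k * th) by ring.
      rewrite cos_plus, sin_plus. unfold Cmult. simpl. f_equal; ring. }
  assert (Hm0 : 0 < INR m) by (apply lt_0_INR; lia).
  assert (Hth : forall al, exists zeta, Cmod zeta = 1 /\ Cpow zeta m = (cos al, sin al)).
  { intros al. exists (cos (al / INR m), sin (al / INR m)). split.
    - unfold Cmod. simpl fst. simpl snd. rewrite <- !Rsqr_pow2, Rplus_comm, sin2_cos2.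
      apply sqrt_1.
    - rewrite Hmoivre. replace (INR m * (al / INR m)) with al by (field; lra). reflexivity. }
  assert (Hal : forall al, cos al * Im b + sin al * Re b < 0 ->
    exists zeta, Cmod zeta = 1 /\ Im (Cpow zeta m * b)%C < 0).
  { intros al H. destruct (Hth al) as (zeta & H1 & H2). exists zeta. split; [exact H1|].
    rewrite H2. exact H. }
  destruct (Rtotal_order (Im b) 0) as [Hi|[Hi|Hi]].
  - apply (Hal 0). rewrite cos_0, sin_0. lra.
  - destruct (Rtotal_order (Re b) 0) as [Hr|[Hr|Hr]].
    + apply (Hal (PI / 2)). rewrite cos_PI2, sin_PI2. lra.
    + elim Hb. destruct b as [p q]. simpl in *. subst. reflexivity.
    + apply (Hal (3 * (PI / 2))). rewrite cos_3PI2, sin_3PI2. lra.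
  - apply (Hal PI). rewrite cos_PI, sin_PI. lra.
Qed.

Lemma upper_half_plane_near (z : C) : upper_half_plane z -> near z upper_half_plane.
Proof.
  unfold upper_half_plane. intros Hz. exists (Im z). split; [exact Hz|].
  intros u Hu. unfold Defs.disc in Hu.
  pose proof (Rle_lt_trans _ _ _ (im_le_Cmod _) Hu) as H.
  change (Rabs (Im u - Im z) < Im z) in H. apply Rabs_def2 in H. lra.
Qed.

(** A local form of the open mapping theorem: if [f - f z0 = (z - z0)^m H] with [H z0 <> 0], then
    moving from [z0] in a suitable direction makes [Im f] negative. So [f] is constant near [z0]. *)
Lemma Pick_Im_zero_near (f : C -> C) (z0 : C) :
  Pick_class f -> upper_half_plane z0 -> Im (f z0) = 0 -> near z0 (fun z => Im (f z) = 0).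
Proof.
  intros Hf Hz0 H0.
  destruct (analytic_order (fun z => (f z - f z0)%C) z0) as [Hc|(m & H & HH & HH0 & Hn)].
  { apply analytic_minus; [apply Hf, Hz0|apply analytic_const]. }
  - refine (near_imp _ _ _ _ Hc). intros z Hz. apply (f_equal Im) in Hz.
    change (Im (f z) - Im (f z0) = 0) in Hz. lra.
  - exfalso.
    assert (Hm : (1 <= m)%nat).
    { destruct m as [|m]; [|lia]. elim HH0. apply near_point in Hn. simpl in Hn.
      rewrite Cmult_1_l in Hn. rewrite <- Hn. ring. }
    destruct (direction_negative_Im (H z0) m HH0 Hm) as (zeta & Hz1 & Hz2).
    set (d := - Im (Cpow zeta m * H z0)%C) in *. assert (Hd : 0 < d) by (unfold d; lra).
    destruct (near_imp3 z0 _ _ _ _ (fun z A B C => conj A (conj B C))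
      (analytic_cont _ _ HH d Hd) Hn (upper_half_plane_near _ Hz0))
      as (r & Hr & Hloc).
    destruct (Hloc (z0 + RtoC (r / 2) * zeta)%C) as (K1 & K2 & K3).
    { unfold Defs.disc. replace (z0 + RtoC (r / 2) * zeta - z0)%C with (RtoC (r / 2) * zeta)%C by ring.
      rewrite Cmod_mult, Hz1, Cmod_R, Rabs_pos_eq; lra. }
    set (z := (z0 + RtoC (r / 2) * zeta)%C) in *.
    replace (z - z0)%C with (RtoC (r / 2) * zeta)%C in K2 by (unfold z; ring).
    rewrite Cpow_mult_l, <- RtoC_pow in K2.
    assert (Hneg : Im (Cpow zeta m * H z)%C < 0).
    { replace (Cpow zeta m * H z)%C
        with (Cpow zeta m * H z0 + Cpow zeta m * (H z - H z0))%C by ring.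
      change (Im (Cpow zeta m * H z0) + Im (Cpow zeta m * (H z - H z0)) < 0)%C.
      assert (Hsm : Rabs (Im (Cpow zeta m * (H z - H z0))%C) < d).
      { eapply Rle_lt_trans; [apply im_le_Cmod|].
        rewrite Cmod_mult, Cmod_pow, Hz1, pow1. lra. }
      apply Rabs_def2 in Hsm. unfold d in *. lra. }
    apply (f_equal Im) in K2.
    change (Im (f z) - Im (f z0) = Im ((RtoC ((r / 2) ^ m) * Cpow zeta m) * H z)%C) in K2.
    rewrite <- Cmult_assoc in K2.
    replace (Im (RtoC ((r / 2) ^ m) * (Cpow zeta m * H z))%C)
      with ((r / 2) ^ m * Im (Cpow zeta m * H z)%C) in K2.
    2:{ unfold Im at 2. unfold Cmult at 3. simpl. unfold Im. simpl. ring. }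
    destruct (Hf z K3) as [_ Hpos].
    assert (Hp : 0 < (r / 2) ^ m) by (apply pow_lt; lra). nra.
Qed.

(** Connectedness of the segment from [z0] to [z1]: its points with [Im f = 0] form a closed set by
    continuity and an open one by the local statement. The argument runs through the supremum [m] of
    the initial stretch on which [Im f] vanishes. *)
Lemma Pick_Im_zero (f : C -> C) (z0 z1 : C) :
  Pick_class f -> upper_half_plane z0 -> upper_half_plane z1 -> Im (f z0) = 0 ->
  Im (f z1) = 0.
Proof.
  intros Hf Hz0 Hz1 H0.
  set (ga := fun s : R => (z0 + RtoC s * (z1 - z0))%C).
  assert (Hga : forall s, 0 <= s <= 1 -> upper_half_plane (ga s)).
  { intros s Hs. unfold upper_half_plane in *.
    replace (Im (ga s)) with ((1 - s) * Im z0 + s * Im z1)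
      by (unfold ga, Im; simpl; ring).
    destruct (Req_dec s 0) as [->|Hs0]; [lra|].
    assert (0 < s * Im z1) by (apply Rmult_lt_0_compat; lra).
    assert (0 <= (1 - s) * Im z0) by (apply Rmult_le_pos; lra). lra. }
  assert (Hgd : forall s s', Cmod (ga s - ga s') = Rabs (s - s') * Cmod (z1 - z0)).
  { intros s s'. replace (ga s - ga s')%C with (RtoC (s - s') * (z1 - z0))%C.
    - now rewrite Cmod_mult, Cmod_R.
    - unfold ga. rewrite RtoC_minus. ring. }
  pose proof (Cmod_ge_0 (z1 - z0)) as HD. set (D := Cmod (z1 - z0)) in *.
  assert (Hnear : forall s P, near (ga s) P ->
    exists d, 0 < d /\ forall s', Rabs (s' - s) < d -> P (ga s')).
  { intros s P (r & Hr & H). exists (r / (D + 1)). split; [apply Rdiv_lt_0_compat; lra|].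
    intros s' Hs'. apply H. unfold Defs.disc. rewrite Hgd.
    apply (Rmult_lt_compat_r (D + 1)) in Hs'; [|lra].
    unfold Rdiv in Hs'. rewrite Rmult_assoc, Rinv_l in Hs' by lra.
    pose proof (Rabs_pos (s' - s)). lra. }
  set (E := fun s => 0 <= s <= 1 /\ forall s', 0 <= s' <= s -> Im (f (ga s')) = 0).
  assert (HE0 : E 0).
  { split; [lra|]. intros s' Hs'. replace s' with 0 by lra.
    replace (ga 0) with z0 by (unfold ga; ring). exact H0. }
  destruct (completeness E) as (m & Hub & Hlub).
  { exists 1. intros s [Hs _]. lra. }
  { exists 0. exact HE0. }
  assert (Hm : 0 <= m <= 1).
  { split; [apply Hub, HE0|]. apply Hlub. intros s [Hs _]. lra. }
  assert (Hbelow : forall s, 0 <= s < m -> Im (f (ga s)) = 0).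
  { intros s Hs. apply Classical_Prop.NNPP. intros Hn.
    enough (m <= s) by lra. apply Hlub. intros s' [Hs1 Hs2].
    apply Rnot_lt_le. intros Hlt. apply Hn, Hs2. lra. }
  assert (Hfm : Im (f (ga m)) = 0).
  { destruct (Req_dec m 0) as [->|Hm0].
    { replace (ga 0) with z0 by (unfold ga; ring). exact H0. }
    apply Classical_Prop.NNPP. intros Hn.
    destruct (Hnear m _ (analytic_near_Im _ _ (proj1 (Hf _ (Hga m Hm))) _ (Rabs_pos_lt _ Hn)))
      as (d & Hd & Hloc).
    set (s := Rmax 0 (m - d / 2)).
    assert (Hs : 0 <= s < m) by (split; [apply Rmax_l|apply Rmax_lub_lt; lra]).
    assert (Hs2 : m - d / 2 <= s) by apply Rmax_r.
    specialize (Hloc s ltac:(apply Rabs_def1; lra)). rewrite Hbelow in Hloc by exact Hs.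
    rewrite Rminus_0_l, Rabs_Ropp in Hloc. lra. }
  destruct (Hnear m _ (Pick_Im_zero_near f _ Hf (Hga m Hm) Hfm)) as (d & Hd & Hloc).
  replace z1 with (ga 1) by (unfold ga; ring).
  destruct (Rle_lt_or_eq_dec m 1) as [Hlt|Heq]; [apply Hm| |now rewrite <- Heq].
  exfalso. set (s := Rmin 1 (m + d / 2)).
  assert (Hs : m < s) by (apply Rmin_glb_lt; lra).
  assert (Hs1 : s <= 1) by apply Rmin_l. assert (Hs2 : s <= m + d / 2) by apply Rmin_r.
  enough (E s) by (specialize (Hub s H); lra).
  split; [lra|]. intros s' Hs'. destruct (Rlt_le_dec s' m) as [Hl|Hl].
  - apply Hbelow. lra.
  - apply Hloc. apply Rabs_def1; lra.
Qed.

(** * Schur complements of the Pick matrix *)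

Definition quad (M : nat -> nat -> R) (c : nat -> R) (k n : nat) : R :=
  sum_n_m (fun i => sum_n_m (fun j => c i * M i j * c j) k n) k n.

Definition pos_def_from (k n : nat) (M : nat -> nat -> R) : Prop :=
  forall c : nat -> R, (exists j, (k <= j <= n)%nat /\ c j <> 0) -> 0 < quad M c k n.

Lemma sum_R_ext (a b : nat -> R) (k n : nat) :
  (forall i, (k <= i <= n)%nat -> a i = b i) -> sum_n_m a k n = sum_n_m b k n :> R.
Proof. exact (sum_n_m_ext_loc (G := R_AbelianMonoid) a b k n). Qed.

Lemma sum_R_zero (a : nat -> R) (k n : nat) :
  (forall i, (k <= i <= n)%nat -> a i = 0) -> sum_n_m a k n = 0 :> R.
Proof.
  intros H. rewrite (sum_R_ext a (fun _ => 0) k n H).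
  exact (sum_n_m_const_zero (G := R_AbelianMonoid) k n).
Qed.

Lemma sum_R_single (a : nat -> R) (j k n : nat) : (k <= j <= n)%nat ->
  sum_n_m (fun i => if Nat.eqb i j then a i else 0) k n = a j :> R.
Proof.
  intros Hj. induction n as [|n IH].
  - replace k with 0%nat by lia. replace j with 0%nat by lia. now rewrite sum_n_n.
  - destruct (Nat.eq_dec k (S n)) as [->|Hk].
    { rewrite sum_n_n. replace j with (S n) by lia. now rewrite Nat.eqb_refl. }
    rewrite sum_n_Sm by lia.
    change (sum_n_m (fun i => if Nat.eqb i j then a i else 0) k n
            + (if Nat.eqb (S n) j then a (S n) else 0) = a j).
    destruct (Nat.eqb_spec (S n) j) as [<-|Hne].
    + rewrite sum_R_zero; [ring|]. intros i Hi. now destruct (Nat.eqb_spec i (S n)); [lia|].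
    + rewrite IH by lia. ring.
Qed.

Lemma pos_def_diag (k n j : nat) (M : nat -> nat -> R) :
  pos_def_from k n M -> (k <= j <= n)%nat -> 0 < M j j.
Proof.
  intros HM Hj. set (c := fun i => if Nat.eqb i j then 1 else 0).
  replace (M j j) with (quad M c k n).
  - apply HM. exists j. split; [exact Hj|]. unfold c. rewrite Nat.eqb_refl. lra.
  - unfold quad. rewrite <- (sum_R_single (fun i => M i j) j k n Hj).
    apply sum_R_ext. intros i _.
    unfold c. destruct (Nat.eqb_spec i j) as [->|Hij].
    + rewrite <- (sum_R_single (fun i => M j i) j k n Hj). apply sum_R_ext.
      intros i _. destruct (Nat.eqb_spec i j); ring.
    + apply sum_R_zero. intros l _. ring.
Qed.

Lemma sum_R_mult_l (r : R) (a : nat -> R) (k n : nat) :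
  sum_n_m (fun i => r * a i) k n = r * sum_n_m a k n.
Proof. exact (sum_n_m_mult_l (K := R_Ring) r a k n). Qed.

Lemma sum_R_plus (a b : nat -> R) (k n : nat) :
  sum_n_m (fun i => a i + b i) k n = sum_n_m a k n + sum_n_m b k n.
Proof. exact (sum_n_m_plus (G := R_AbelianMonoid) a b k n). Qed.

Lemma sum_R_first (a : nat -> R) (k n : nat) : (k <= n)%nat ->
  sum_n_m a k n = a k + sum_n_m a (S k) n.
Proof. intros H. exact (sum_Sn_m (G := R_AbelianMonoid) a k n H). Qed.

(** Completing the square: the vector [d c] on the indices after [k] is extended by [- L / M k k],
    the coordinate minimising the form of [M]; the minimum is the form of the Schur complement.
    Nonvanishing of [d] keeps the vector nonzero. *)
Lemma pos_def_Schur (k n : nat) (M M' : nat -> nat -> R) (d : nat -> R) :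
  pos_def_from k n M -> (k < n)%nat ->
  (forall j, (k < j <= n)%nat -> M k j = M j k) ->
  (forall j, (k < j <= n)%nat -> d j <> 0) ->
  (forall i j, (k < i <= n)%nat -> (k < j <= n)%nat ->
     M' i j = d i * d j * (M i j - M i k * M j k / M k k)) ->
  pos_def_from (S k) n M'.
Proof.
  intros HM Hkn Hsym Hd HM' c (j0 & Hj0 & Hc0).
  assert (Hkk : 0 < M k k) by (apply (pos_def_diag k n); [exact HM|lia]).
  set (e := fun i => d i * c i).
  set (L := sum_n_m (fun j => M j k * e j) (S k) n).
  set (c' := fun i => if Nat.eqb i k then - L / M k k else e i).
  assert (Hc'k : c' k = - L / M k k) by (unfold c'; now rewrite Nat.eqb_refl).
  assert (Hc' : forall i, (S k <= i <= n)%nat -> c' i = e i).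
  { intros i Hi. unfold c'. destruct (Nat.eqb_spec i k); [lia|reflexivity]. }
  replace (quad M' c (S k) n) with (quad M c' k n).
  { apply HM. exists j0. split; [lia|]. rewrite Hc' by lia. unfold e.
    apply Rmult_integral_contrapositive_currified; [apply Hd; lia|exact Hc0]. }
  unfold quad.
  assert (H1 : quad M' c (S k) n = quad M e (S k) n - L * L / M k k).
  { unfold quad.
    rewrite (sum_R_ext _ (fun i => sum_n_m (fun j => e i * M i j * e j) (S k) n
      + (- L / M k k) * (M i k * e i))).
    - rewrite sum_R_plus, sum_R_mult_l. fold L. field. lra.
    - intros i Hi.
      rewrite (sum_R_ext _ (fun j => e i * M i j * e j
        + (- (M i k * e i) / M k k) * (M j k * e j))).
      + rewrite sum_R_plus, sum_R_mult_l. fold L. field. lra.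
      + intros j Hj. rewrite HM' by lia. unfold e. field. lra. }
  fold (quad M' c (S k) n). rewrite H1. rewrite sum_R_first by lia.
  rewrite (sum_R_first _ k n) by lia.
  rewrite (sum_R_ext _ (fun j => (- L / M k k) * (M j k * e j)) (S k) n).
  2:{ intros j Hj. rewrite Hc'k, (Hc' j), (Hsym j) by lia. ring. }
  rewrite sum_R_mult_l. fold L.
  rewrite (sum_R_ext _ (fun i => (- L / M k k) * (M i k * e i)
      + sum_n_m (fun j => e i * M i j * e j) (S k) n) (S k) n).
  - rewrite sum_R_plus, sum_R_mult_l. fold L. fold (quad M e (S k) n).
    rewrite Hc'k. field. lra.
  - intros i Hi. rewrite sum_R_first by lia. rewrite Hc'k, (Hc' i) by lia. f_equal; [ring|].
    apply sum_R_ext. intros j Hj. now rewrite Hc'.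
Qed.

(** The Pick matrix of data some of whose values are [Inf]; with [w = p / q] in
    homogeneous coordinates its entries are [(p_i q_j - p_j q_i) / (x_i - x_j)]. *)
Definition Pick_matrix_pt (x : nat -> R) (w : nat -> onept R) (v : nat -> R)
    (i j : nat) : R :=
  if Nat.eqb i j then v i else
  match w i, w j with
  | Fin a, Fin b => (a - b) / (x i - x j)
  | Inf, Fin _ => 1 / (x i - x j)
  | Fin _, Inf => - (1 / (x i - x j))
  | Inf, Inf => 0
  end.

Lemma w_rec_S x w v k j : (1 <= k)%nat ->
  w_rec x w v (S k) j = w_step x k (w_rec x w v k) (v_rec x w v k) j.
Proof. destruct k as [|k]; [lia|reflexivity]. Qed.

Lemma v_rec_S x w v k j : (1 <= k)%nat ->
  v_rec x w v (S k) j = v_step x k (w_rec x w v k) (v_rec x w v k) j.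
Proof. destruct k as [|k]; [lia|reflexivity]. Qed.

(** The scaling of the homogeneous coordinates caused by one step of the recursion. *)
Definition Schur_scale (wk wj : onept R) : R :=
  match wk, wj with
  | Fin a, Fin b => if Req_EM_T b a then -1 else 1 / (b - a)
  | _, _ => 1
  end.

Lemma Schur_scale_nonzero wk wj : Schur_scale wk wj <> 0.
Proof.
  unfold Schur_scale. destruct wk as [a|], wj as [b|]; try apply R1_neq_R0.
  destruct (Req_EM_T b a) as [_|Hne]; [lra|].
  unfold Rdiv. rewrite Rmult_1_l. apply Rinv_neq_0_compat. lra.
Qed.

(** Put [T = 1 / (v k (x j - x k))]. For finite [w k = a] the coordinates [(b, 1)] are sent to
    [(T (b - a) - 1, b - a)]; normalising these to [(w', 1)] or [(1, 0)] produces the factors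
    [1 / (b - a)] and [-1] of [Schur_scale]. In the other cases the image is already normalised. *)
Lemma Pick_matrix_pt_step x w v k i j :
  0 < v k -> i <> k -> j <> k -> x i <> x k -> x j <> x k -> (i <> j -> x i <> x j) ->
  Pick_matrix_pt x (w_step x k w v) (v_step x k w v) i j =
  Schur_scale (w k) (w i) * Schur_scale (w k) (w j) *
    (Pick_matrix_pt x w v i j -
     Pick_matrix_pt x w v i k * Pick_matrix_pt x w v j k / Pick_matrix_pt x w v k k).
Proof.
  intros Hv Hik Hjk Hxi Hxj Hxij. unfold Pick_matrix_pt, w_step, v_step, Schur_scale.
  rewrite (proj2 (Nat.eqb_neq i k) Hik), (proj2 (Nat.eqb_neq j k) Hjk), Nat.eqb_refl.
  destruct (Nat.eqb_spec i j) as [<-|Hij].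
  - destruct (w k) as [a|], (w i) as [b|];
      try destruct (Req_EM_T b a) as [->|Hne]; field;
      repeat split; lra.
  - specialize (Hxij Hij).
    destruct (w k) as [a|], (w i) as [b|], (w j) as [c|];
      try destruct (Req_EM_T b a) as [->|Hne];
      try destruct (Req_EM_T c a) as [->|Hne'];
      field; repeat split; lra.
Qed.

Lemma Pick_matrix_pt_sym x w v k j :
  x j <> x k -> j <> k -> Pick_matrix_pt x w v k j = Pick_matrix_pt x w v j k.
Proof.
  intros Hx Hjk. unfold Pick_matrix_pt.
  rewrite (proj2 (Nat.eqb_neq j k) Hjk), (proj2 (Nat.eqb_neq k j) (not_eq_sym Hjk)).
  destruct (w k), (w j); field; lra.
Qed.

Lemma Pick_matrix_pt_pos_def n x w v k :
  (forall i j : nat, (1 <= i <= n)%nat -> (1 <= j <= n)%nat -> x i = x j -> i = j) ->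
  positive_definite n (Pick_matrix x w v) -> (1 <= k <= n)%nat ->
  pos_def_from k n (Pick_matrix_pt x (w_rec x w v k) (v_rec x w v k)).
Proof.
  intros Hx HM. induction k as [|k IH]; [lia|]. intros Hk.
  destruct (Nat.eq_dec k 0) as [->|Hk0].
  (* The data with superscript [1] are finite, so both Pick matrices are convertible. *)
  { intros c Hc. exact (HM c Hc). }
  specialize (IH ltac:(lia)).
  assert (Hne : forall i j, (1 <= i <= n)%nat -> (1 <= j <= n)%nat -> i <> j -> x i <> x j).
  { intros i j Hi Hj Hij E. exact (Hij (Hx i j Hi Hj E)). }
  assert (Hpos : 0 < v_rec x w v k k).
  { pose proof (pos_def_diag _ _ k _ IH ltac:(lia)) as H.
    unfold Pick_matrix_pt in H. now rewrite Nat.eqb_refl in H. }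
  apply (pos_def_Schur k n _ _
    (fun i => Schur_scale (w_rec x w v k k) (w_rec x w v k i)) IH ltac:(lia)).
  - intros j Hj. apply Pick_matrix_pt_sym; [apply Hne|]; lia.
  - intros j _. apply Schur_scale_nonzero.
  - intros i j Hi Hj.
    rewrite <- (Pick_matrix_pt_step x (w_rec x w v k) (v_rec x w v k) k i j Hpos
      ltac:(lia) ltac:(lia) (Hne i k ltac:(lia) ltac:(lia) ltac:(lia))
      (Hne j k ltac:(lia) ltac:(lia) ltac:(lia)) (Hne i j ltac:(lia) ltac:(lia))).
    unfold Pick_matrix_pt. rewrite (v_rec_S _ _ _ k i), !w_rec_S by lia. reflexivity.
Qed.

Lemma v_rec_pos n x w v k j :
  (forall i j : nat, (1 <= i <= n)%nat -> (1 <= j <= n)%nat -> x i = x j -> i = j) ->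
  positive_definite n (Pick_matrix x w v) -> (1 <= k)%nat -> (k <= j <= n)%nat ->
  0 < v_rec x w v k j.
Proof.
  intros Hx HM Hk Hj.
  pose proof (pos_def_diag _ _ j _ (Pick_matrix_pt_pos_def n x w v k Hx HM ltac:(lia)) Hj) as H.
  unfold Pick_matrix_pt in H. now rewrite Nat.eqb_refl in H.
Qed.

(** * One augmentation step *)

Lemma analytic_near_const k c : analytic_near (fun _ => k) c.
Proof. apply near_all. intros z. apply analytic_const. Qed.

Lemma analytic_near_id c : analytic_near (fun z => z) c.
Proof. apply near_all. apply analytic_id. Qed.

Lemma analytic_near_plus F G c : analytic_near F c -> analytic_near G c ->
  analytic_near (fun z => (F z + G z)%C) c.
Proof. apply near_imp2. intros z. apply analytic_plus. Qed.

Lemma analytic_near_opp F c : analytic_near F c -> analytic_near (fun z => (- F z)%C) c.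
Proof. apply near_imp. intros z. apply analytic_opp. Qed.

Lemma analytic_near_minus F G c : analytic_near F c -> analytic_near G c ->
  analytic_near (fun z => (F z - G z)%C) c.
Proof. apply near_imp2. intros z. apply analytic_minus. Qed.

Lemma analytic_near_mult F G c : analytic_near F c -> analytic_near G c ->
  analytic_near (fun z => (F z * G z)%C) c.
Proof. apply near_imp2. intros z. apply analytic_mult. Qed.

Lemma analytic_near_ne0 F c : analytic_near F c -> F c <> 0 -> near c (fun z => F z <> 0).
Proof. intros HF. apply analytic_near_nonzero. exact (near_point _ _ HF). Qed.

Lemma analytic_near_div F G c : analytic_near F c -> analytic_near G c -> G c <> 0 ->
  analytic_near (fun z => (F z / G z)%C) c.
Proof.
  intros HF HG H0. refine (near_imp3 _ _ _ _ _ _ HF HG (analytic_near_ne0 _ _ HG H0)).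
  intros z. apply analytic_div.
Qed.

Lemma analytic_near_pow F c m : analytic_near F c -> analytic_near (fun z => Cpow (F z) m) c.
Proof. apply near_imp. intros z. apply analytic_pow. Qed.

Create HintDb analytic.
#[local] Hint Resolve analytic_near_const analytic_near_id analytic_near_plus analytic_near_opp
  analytic_near_minus analytic_near_mult analytic_near_pow : analytic.

Lemma half_plane_minus_ne0 z (x : R) : upper_half_plane z -> (z - RtoC x)%C <> 0.
Proof.
  intros Hz E. apply (f_equal Im) in E. unfold upper_half_plane in Hz.
  unfold Cminus in E. rewrite im_plus, im_opp, !im_RtoC in E. lra.
Qed.

Lemma RtoC_ne0 (r : R) : r <> 0 -> RtoC r <> 0.
Proof. intros H E. apply H. now apply RtoC_inj. Qed.

(** Discharges side conditions of [field] that agree with a hypothesis up to [ring] and sign. *)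
Ltac ne0 := repeat split;
  first
  [ assumption
  | exact C1_nz
  | match goal with
    | H : ?e <> _ |- ?g <> _ =>
        solve [ let E := fresh in intros E; apply H; replace e with g by ring; exact E
              | let E := fresh in
                intros E; apply H; replace e with (- g)%C by ring; rewrite E; ring ]
    end ].

(** * The two Moebius steps and their action on jets and forbidden values *)

Definition tau (t x : R) (z : C) : C := (1 / (RtoC t * (z - RtoC x)))%C.

Definition augment (a0 : onept R) (t x : R) (g : C -> C) (z : C) : C :=
  match a0 with
  | Fin a => (RtoC a + 1 / (tau t x z - g z))%C
  | Inf => (g z - tau t x z)%C
  end.

Definition reduce (a0 : onept R) (t x : R) (f : C -> C) (z : C) : C :=
  match a0 with
  | Fin a => (- (1 / (f z - RtoC a)) + tau t x z)%C
  | Inf => (f z + tau t x z)%C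
  end.

(** At value [Inf] the difference quotient [q] is that of [-1/f], which vanishes there. *)
Definition jet (w : onept R) (h q : C) : C :=
  match w with
  | Fin a => (RtoC a + h * q)%C
  | Inf => (- (1 / (h * q)))%C
  end.

(** Value and derivative are stored in one analytic function, the difference quotient at [x], whose
    value there is the derivative. This covers finite and infinite values alike and constrains [f]
    in the half-plane only. *)
Definition boundary_data (f : C -> C) (x : R) (w : onept R) (v : R) : Prop :=
  exists F1 : C -> C, analytic_near F1 (RtoC x) /\ F1 (RtoC x) = RtoC v /\
    near (RtoC x) (fun z => upper_half_plane z -> f z = jet w (z - RtoC x) (F1 z)).

(** [P] and [Q] are homogeneous coordinates of the sphere-valued extension of [f]; the last
    condition says that its value differs from [y], and also excludes [P x = Q x = 0]. *)
Definition avoids (f : C -> C) (x : R) (y : onept R) : Prop :=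
  exists P Q : C -> C, analytic_near P (RtoC x) /\ analytic_near Q (RtoC x) /\
    near (RtoC x) (fun z => upper_half_plane z -> Q z <> 0 /\ f z = (P z / Q z)%C) /\
    match y with
    | Fin b => (P (RtoC x) - RtoC b * Q (RtoC x))%C <> 0
    | Inf => Q (RtoC x) <> 0
    end.

(** The constant term is the summand contributed to [w_step], and [K] at the node is the summand
    contributed to [v_step]. *)
Lemma tau_expand (t xk xj : R) : t <> 0 -> xj <> xk ->
  exists K, analytic_near K (RtoC xj) /\ K (RtoC xj) = RtoC (- (1 / (t * (xj - xk) ^ 2))) /\
    forall z, z <> RtoC xk ->
      tau t xk z = (RtoC (1 / (t * (xj - xk))) + (z - RtoC xj) * K z)%C.
Proof.
  intros Ht Hx.
  assert (Hd : xj - xk <> 0) by lra.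
  pose proof (RtoC_ne0 t Ht) as Ht'. pose proof (RtoC_ne0 _ Hd) as Hd'.
  rewrite RtoC_minus in Hd'.
  exists (fun z => (- (1 / (RtoC t * (RtoC xj - RtoC xk) * (z - RtoC xk))))%C).
  split; [|split].
  - apply analytic_near_opp, analytic_near_div; auto with analytic.
    repeat apply Cmult_neq_0; assumption.
  - rewrite RtoC_opp, RtoC_div, RtoC_mult, RtoC_pow, RtoC_minus.
    + field. auto.
    + apply Rmult_integral_contrapositive_currified; [exact Ht|]. now apply pow_nonzero.
  - intros z Hz. assert (Hz' : (z - RtoC xk)%C <> 0) by now apply Cminus_eq_contra.
    unfold tau. rewrite RtoC_div, RtoC_mult, RtoC_minus.
    + field. auto.
    + now apply Rmult_integral_contrapositive_currified.
Qed.

Lemma half_plane_ne_R z (x : R) : upper_half_plane z -> z <> RtoC x.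
Proof. intros Hz E. apply (half_plane_minus_ne0 z x Hz). rewrite E. ring. Qed.

(** In each case the new difference quotient is written out, [D] being the cleared denominator,
    nonzero at [x j]. If the new value is [Inf], it is the quotient of [-1] over the reduced
    function: with [h = z - x j], [f = a + h F] gives [h F / (1 - tau h F)]. From [v j <> 0] it
    follows that [F] does not vanish near the node. *)
Lemma reduce_boundary_data (f : C -> C) (x : nat -> R) (w : nat -> onept R) (v : nat -> R)
    (k j : nat) :
  v k <> 0 -> v j <> 0 -> x j <> x k ->
  boundary_data f (x j) (w j) (v j) ->
  boundary_data (reduce (w k) (v k) (x k) f) (x j) (w_step x k w v j) (v_step x k w v j).
Proof.
  intros Hvk Hvj Hx (F & HF & HFx & Hf).
  destruct (tau_expand (v k) (x k) (x j) Hvk Hx) as (K & HK & HKx & Htau).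
  assert (HF0 : near (RtoC (x j)) (fun z => F z <> 0)).
  { apply analytic_near_ne0; [exact HF|]. rewrite HFx. now apply RtoC_ne0. }
  unfold w_step, v_step, reduce, boundary_data.
  set (T := 1 / (v k * (x j - x k))) in *. set (S := 1 / (v k * (x j - x k) ^ 2)) in *.
  set (X := RtoC (x j)) in *.
  destruct (w k) as [a|], (w j) as [b|].
  - destruct (Req_EM_T b a) as [->|Hba].
    + set (D := fun z => (1 - (RtoC T + (z - X) * K z) * (z - X) * F z)%C).
      assert (HD : analytic_near D X) by (unfold D; auto 10 with analytic).
      assert (HDx : D X = 1) by (unfold D; ring).
      exists (fun z => (F z / D z)%C). split; [|split].
      * apply analytic_near_div; auto. rewrite HDx. apply C1_nz.
      * cbv beta; fold X. rewrite HDx, HFx. field.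
      * refine (near_imp3 _ _ _ _ _ _ Hf HF0 (analytic_near_ne0 D X HD _)).
        { intros z Hfz HFz HDz Hz. rewrite (Hfz Hz), Htau by now apply half_plane_ne_R.
          pose proof (half_plane_minus_ne0 z (x j) Hz). fold X in H |- *. pose proof (Cmult_neq_0 _ _ H HFz). simpl.
          unfold D in HDz |- *. field. ne0. }
        rewrite HDx. apply C1_nz.
    + assert (Hba' : (RtoC b - RtoC a)%C <> 0).
      { rewrite <- RtoC_minus. apply RtoC_ne0. lra. }
      set (D := fun z => (RtoC b - RtoC a + (z - X) * F z)%C).
      assert (HD : analytic_near D X) by (unfold D; auto 10 with analytic).
      assert (HDx : D X = (RtoC b - RtoC a)%C) by (unfold D; ring).
      exists (fun z => (F z / ((RtoC b - RtoC a) * D z) + K z)%C). split; [|split].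
      * apply analytic_near_plus; [|exact HK].
        apply analytic_near_div; auto with analytic.
        rewrite HDx. now apply Cmult_neq_0.
      * cbv beta; fold X. rewrite HDx, HFx, HKx.
        unfold Rminus. rewrite RtoC_plus, !RtoC_opp, RtoC_div, RtoC_pow, RtoC_plus, RtoC_opp.
        -- field. exact Hba'.
        -- apply pow_nonzero. lra.
      * refine (near_imp2 _ _ _ _ _ Hf (analytic_near_ne0 D X HD _)).
        { intros z Hfz HDz Hz. rewrite (Hfz Hz), Htau by now apply half_plane_ne_R.
          fold X. simpl. rewrite RtoC_plus, RtoC_opp, RtoC_div, RtoC_minus by lra.
          unfold D in HDz |- *. field. ne0. }
        now rewrite HDx.
  - set (D := fun z => (1 + RtoC a * (z - X) * F z)%C).
    assert (HD : analytic_near D X) by (unfold D; auto 10 with analytic).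
    assert (HDx : D X = 1) by (unfold D; ring).
    exists (fun z => (F z / D z + K z)%C). split; [|split].
    + apply analytic_near_plus; [|exact HK].
      apply analytic_near_div; auto. rewrite HDx. apply C1_nz.
    + cbv beta; fold X. rewrite HDx, HFx, HKx. unfold Rminus. rewrite RtoC_plus. field.
    + refine (near_imp3 _ _ _ _ _ _ Hf HF0 (analytic_near_ne0 D X HD _)).
      { intros z Hfz HFz HDz Hz. rewrite (Hfz Hz), Htau by now apply half_plane_ne_R.
        pose proof (half_plane_minus_ne0 z (x j) Hz). fold X in H |- *. pose proof (Cmult_neq_0 _ _ H HFz). simpl.
        unfold D in HDz |- *. field. ne0. }
      rewrite HDx. apply C1_nz.
  - exists (fun z => (F z + K z)%C). split; [auto with analytic|]. split.
    + cbv beta; fold X. rewrite HFx, HKx. unfold Rminus. now rewrite RtoC_plus.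
    + refine (near_imp _ _ _ _ Hf). intros z Hfz Hz.
      rewrite (Hfz Hz), Htau by now apply half_plane_ne_R.
      fold X. simpl. rewrite RtoC_plus. ring.
  - set (D := fun z => (1 - (RtoC T + (z - X) * K z) * (z - X) * F z)%C).
    assert (HD : analytic_near D X) by (unfold D; auto 10 with analytic).
    assert (HDx : D X = 1) by (unfold D; ring).
    exists (fun z => (F z / D z)%C). split; [|split].
    + apply analytic_near_div; auto. rewrite HDx. apply C1_nz.
    + cbv beta; fold X. rewrite HDx, HFx. field.
    + refine (near_imp3 _ _ _ _ _ _ Hf HF0 (analytic_near_ne0 D X HD _)).
      { intros z Hfz HFz HDz Hz. rewrite (Hfz Hz), Htau by now apply half_plane_ne_R.
        pose proof (half_plane_minus_ne0 z (x j) Hz). fold X in H |- *. pose proof (Cmult_neq_0 _ _ H HFz). simpl.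
        unfold D in HDz |- *. field. ne0. }
      rewrite HDx. apply C1_nz.
Qed.

Lemma augment_boundary_data (g : C -> C) (x : nat -> R) (w : nat -> onept R) (v : nat -> R)
    (k j : nat) :
  v k <> 0 -> v j <> 0 -> x j <> x k ->
  boundary_data g (x j) (w_step x k w v j) (v_step x k w v j) ->
  boundary_data (augment (w k) (v k) (x k) g) (x j) (w j) (v j).
Proof.
  intros Hvk Hvj Hx.
  destruct (tau_expand (v k) (x k) (x j) Hvk Hx) as (K & HK & HKx & Htau).
  unfold w_step, v_step, augment, boundary_data.
  set (T := 1 / (v k * (x j - x k))) in *. set (S := 1 / (v k * (x j - x k) ^ 2)) in *.
  set (X := RtoC (x j)) in *.
  destruct (w k) as [a|], (w j) as [b|].
  - destruct (Req_EM_T b a) as [->|Hba]; intros (G & HG & HGx & Hg).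
    + assert (HG0 : near X (fun z => G z <> 0)).
      { apply analytic_near_ne0; [exact HG|]. rewrite HGx. now apply RtoC_ne0. }
      set (D := fun z => (1 + (RtoC T + (z - X) * K z) * (z - X) * G z)%C).
      assert (HD : analytic_near D X) by (unfold D; auto 10 with analytic).
      assert (HDx : D X = 1) by (unfold D; ring).
      exists (fun z => (G z / D z)%C). split; [|split].
      * apply analytic_near_div; auto. rewrite HDx. apply C1_nz.
      * rewrite HDx, HGx. field.
      * refine (near_imp3 _ _ _ _ _ _ Hg HG0 (analytic_near_ne0 D X HD _)).
        { intros z Hgz HGz HDz Hz. rewrite (Hgz Hz), Htau by now apply half_plane_ne_R.
          pose proof (half_plane_minus_ne0 z (x j) Hz). fold X in H |- *.
          pose proof (Cmult_neq_0 _ _ H HGz). simpl.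
          unfold D in HDz |- *. field. ne0. }
        rewrite HDx. apply C1_nz.
    + assert (Hba' : (RtoC b - RtoC a)%C <> 0).
      { rewrite <- RtoC_minus. apply RtoC_ne0. lra. }
      set (D := fun z => (1 + (RtoC b - RtoC a) * (z - X) * (K z - G z))%C).
      assert (HD : analytic_near D X) by (unfold D; auto 10 with analytic).
      assert (HDx : D X = 1) by (unfold D; ring).
      exists (fun z => ((RtoC b - RtoC a) * (RtoC b - RtoC a) * (G z - K z) / D z)%C).
      split; [|split].
      * apply analytic_near_div; auto with analytic. rewrite HDx. apply C1_nz.
      * rewrite HDx, HGx, HKx.
        unfold Rminus. rewrite RtoC_plus, !RtoC_opp, RtoC_div, RtoC_pow, RtoC_plus, RtoC_opp.
        -- field. exact Hba'.
        -- apply pow_nonzero. lra.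
      * refine (near_imp2 _ _ _ _ _ Hg (analytic_near_ne0 D X HD _)).
        { intros z Hgz HDz Hz. rewrite (Hgz Hz), Htau by now apply half_plane_ne_R.
          simpl. rewrite RtoC_plus, RtoC_opp, RtoC_div, RtoC_minus by lra.
          unfold D in HDz |- *. field. ne0. }
        rewrite HDx. apply C1_nz.
  - intros (G & HG & HGx & Hg).
    (* Here [tau - g = (z - x j) L] vanishes at the node, which creates the pole of [f]. The
       recursion for [v] makes its derivative [- v j], so the pole is simple with the right
       coefficient. *)
    set (L := fun z => (K z - G z)%C).
    assert (HL : analytic_near L X) by (unfold L; auto with analytic).
    assert (HLx : L X = (- RtoC (v j))%C).
    { unfold L. rewrite HGx, HKx, <- RtoC_minus, <- RtoC_opp. f_equal. ring. }
    assert (HL0 : near X (fun z => L z <> 0)).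
    { apply analytic_near_ne0; [exact HL|]. rewrite HLx, <- RtoC_opp. apply RtoC_ne0. lra. }
    set (D := fun z => (1 + RtoC a * (z - X) * L z)%C).
    assert (HD : analytic_near D X) by (unfold D; auto 10 with analytic).
    assert (HDx : D X = 1) by (unfold D; ring).
    exists (fun z => (- L z / D z)%C). split; [|split].
    + apply analytic_near_div; auto with analytic. rewrite HDx. apply C1_nz.
    + rewrite HDx, HLx. field.
    + refine (near_imp3 _ _ _ _ _ _ Hg HL0 (analytic_near_ne0 D X HD _)).
      { intros z Hgz HLz HDz Hz. rewrite (Hgz Hz), Htau by now apply half_plane_ne_R.
        pose proof (half_plane_minus_ne0 z (x j) Hz). fold X in H |- *.
        pose proof (Cmult_neq_0 _ _ H HLz). simpl.
        unfold D, L in *. field. ne0. }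
      rewrite HDx. apply C1_nz.
  - intros (G & HG & HGx & Hg).
    exists (fun z => (G z - K z)%C). split; [auto with analytic|]. split.
    + rewrite HGx, HKx, <- RtoC_minus. f_equal. ring.
    + refine (near_imp _ _ _ _ Hg). intros z Hgz Hz.
      rewrite (Hgz Hz), Htau by now apply half_plane_ne_R.
      simpl. rewrite RtoC_plus. ring.
  - intros (G & HG & HGx & Hg).
    assert (HG0 : near X (fun z => G z <> 0)).
    { apply analytic_near_ne0; [exact HG|]. rewrite HGx. now apply RtoC_ne0. }
    set (D := fun z => (1 + (RtoC T + (z - X) * K z) * (z - X) * G z)%C).
    assert (HD : analytic_near D X) by (unfold D; auto 10 with analytic).
    assert (HDx : D X = 1) by (unfold D; ring).
    exists (fun z => (G z / D z)%C). split; [|split].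
    + apply analytic_near_div; auto. rewrite HDx. apply C1_nz.
    + rewrite HDx, HGx. field.
    + refine (near_imp3 _ _ _ _ _ _ Hg HG0 (analytic_near_ne0 D X HD _)).
      { intros z Hgz HGz HDz Hz. rewrite (Hgz Hz), Htau by now apply half_plane_ne_R.
        pose proof (half_plane_minus_ne0 z (x j) Hz). fold X in H |- *.
        pose proof (Cmult_neq_0 _ _ H HGz). simpl.
        unfold D in HDz |- *. field. ne0. }
      rewrite HDx. apply C1_nz.
Qed.

(** The action of one reduction on the real projective line, with [tau] frozen at its value [T] at
    the node. *)
Definition y_step (wk : onept R) (T : R) (y : onept R) : onept R :=
  match wk, y with
  | Fin a, Fin b => if Req_EM_T b a then Inf else Fin (- (1 / (b - a)) + T)
  | Fin _, Inf => Fin T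
  | Inf, Fin b => Fin (b + T)
  | Inf, Inf => Inf
  end.

Lemma analytic_near_tau (t xk xj : R) : t <> 0 -> xj <> xk ->
  analytic_near (tau t xk) (RtoC xj) /\ tau t xk (RtoC xj) = RtoC (1 / (t * (xj - xk))).
Proof.
  intros Ht Hx. assert (Hd : xj - xk <> 0) by lra.
  pose proof (RtoC_ne0 t Ht) as Ht'. pose proof (RtoC_ne0 _ Hd) as Hd'.
  rewrite RtoC_minus in Hd'. split.
  - apply analytic_near_div; auto with analytic. now apply Cmult_neq_0.
  - unfold tau. rewrite RtoC_div, RtoC_mult, RtoC_minus; [reflexivity|].
    now apply Rmult_integral_contrapositive_currified.
Qed.

(** On homogeneous coordinates the Moebius map is linear and invertible, so poles of [f] need no
    separate treatment and a value other than [y] goes to a value other than the image of [y]. The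
    hypothesis on [f] keeps the new denominator nonzero in the half-plane. *)
Lemma reduce_avoids (f : C -> C) (a0 y : onept R) (t xk xj : R) :
  t <> 0 -> xj <> xk ->
  (forall z, upper_half_plane z -> match a0 with Fin a => f z <> RtoC a | Inf => True end) ->
  avoids f xj y ->
  avoids (reduce a0 t xk f) xj (y_step a0 (1 / (t * (xj - xk))) y).
Proof.
  intros Ht Hx Hfa (P & Q & HP & HQ & Hf & Hy).
  destruct (analytic_near_tau t xk xj Ht Hx) as [Htau Htx].
  unfold reduce, y_step. set (T := 1 / (t * (xj - xk))) in *.
  destruct a0 as [a|].
  - exists (fun z => (- Q z + tau t xk z * (P z - RtoC a * Q z))%C),
      (fun z => (P z - RtoC a * Q z)%C).
    split; [auto 10 with analytic|]. split; [auto 10 with analytic|]. split.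
    + refine (near_imp _ _ _ _ Hf). intros z Hfz Hz. destruct (Hfz Hz) as [HQz Hfz'].
      assert (Hne : (P z - RtoC a * Q z)%C <> 0).
      { intros E. apply (Hfa z Hz). rewrite Hfz'.
        replace (P z) with (RtoC a * Q z + (P z - RtoC a * Q z))%C by ring.
        rewrite E. field. exact HQz. }
      split; [exact Hne|]. rewrite Hfz'. field. ne0.
    + destruct y as [b|].
      * destruct (Req_EM_T b a) as [->|Hba]; [exact Hy|].
        assert (Hba' : (RtoC b - RtoC a)%C <> 0).
        { rewrite <- RtoC_minus. apply RtoC_ne0. lra. }
        rewrite Htx, RtoC_plus, RtoC_opp, RtoC_div, RtoC_minus by lra.
        intros E. apply Hy.
        match type of E with ?e = _ =>
          replace (P (RtoC xj) - RtoC b * Q (RtoC xj))%C with ((RtoC b - RtoC a) * e)%C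
            by (field; exact Hba') end.
        rewrite E. ring.
      * rewrite Htx. ne0.
  - exists (fun z => (P z + tau t xk z * Q z)%C), Q.
    split; [auto 10 with analytic|]. split; [exact HQ|]. split.
    + refine (near_imp _ _ _ _ Hf). intros z Hfz Hz. destruct (Hfz Hz) as [HQz Hfz'].
      split; [exact HQz|]. rewrite Hfz'. field. exact HQz.
    + destruct y as [b|]; [|exact Hy]. rewrite Htx, RtoC_plus. ne0.
Qed.

Lemma augment_avoids (g : C -> C) (a0 y : onept R) (t xk xj : R) :
  t <> 0 -> xj <> xk ->
  (forall z, upper_half_plane z -> (tau t xk z - g z)%C <> 0) ->
  avoids g xj (y_step a0 (1 / (t * (xj - xk))) y) ->
  avoids (augment a0 t xk g) xj y.
Proof.
  intros Ht Hx Hne (P & Q & HP & HQ & Hg & Hy).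
  destruct (analytic_near_tau t xk xj Ht Hx) as [Htau Htx].
  unfold augment, y_step in *. set (T := 1 / (t * (xj - xk))) in *.
  destruct a0 as [a|].
  - exists (fun z => (RtoC a * (tau t xk z * Q z - P z) + Q z)%C),
      (fun z => (tau t xk z * Q z - P z)%C).
    split; [auto 10 with analytic|]. split; [auto 10 with analytic|]. split.
    + refine (near_imp _ _ _ _ Hg). intros z Hgz Hz. destruct (Hgz Hz) as [HQz Hgz'].
      assert (Hd : (tau t xk z * Q z - P z)%C <> 0).
      { intros E. apply (Hne z Hz). rewrite Hgz'.
        replace (P z) with (tau t xk z * Q z - (tau t xk z * Q z - P z))%C by ring.
        rewrite E. field. exact HQz. }
      split; [exact Hd|]. rewrite Hgz'. field. ne0.
    + destruct y as [b|].
      * destruct (Req_EM_T b a) as [->|Hba].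
        { rewrite Htx. ne0. }
        assert (Hba' : (RtoC b - RtoC a)%C <> 0).
        { rewrite <- RtoC_minus. apply RtoC_ne0. lra. }
        rewrite RtoC_plus, RtoC_opp, RtoC_div, RtoC_minus in Hy by lra.
        rewrite Htx. intros E. apply Hy.
        match type of E with ?e = _ =>
          match goal with |- ?u = _ =>
            replace u with (e / (RtoC b - RtoC a))%C by (field; exact Hba') end end.
        rewrite E. field. exact Hba'.
      * rewrite Htx. ne0.
  - exists (fun z => (P z - tau t xk z * Q z)%C), Q.
    split; [auto 10 with analytic|]. split; [exact HQ|]. split.
    + refine (near_imp _ _ _ _ Hg). intros z Hgz Hz. destruct (Hgz Hz) as [HQz Hgz'].
      split; [exact HQz|]. rewrite Hgz'. field. exact HQz.
    + destruct y as [b|]; [|exact Hy]. rewrite RtoC_plus in Hy. rewrite Htx. ne0.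
Qed.

(** With [h = z - x] and [F = t + h H], one has [- 1 / (h F) + 1 / (t h) = H / (t F)], whether [a0]
    is finite or not: the prescribed derivative [t] is what cancels the pole. *)
Lemma reduce_removable (f : C -> C) (x t : R) (a0 : onept R) :
  t <> 0 -> boundary_data f x a0 t ->
  exists G, analytic_near G (RtoC x) /\
    near (RtoC x) (fun z => upper_half_plane z -> reduce a0 t x f z = G z).
Proof.
  intros Ht (F & HF & HFx & Hf). pose proof (RtoC_ne0 t Ht) as Ht'.
  assert (HF0 : near (RtoC x) (fun z => F z <> 0)).
  { apply analytic_near_ne0; [exact HF|]. now rewrite HFx. }
  destruct (analytic_near_factor F (RtoC x) HF) as (H & HH & HFH). rewrite HFx in HFH.
  exists (fun z => (H z / (RtoC t * F z))%C). split.
  - apply analytic_near_div; auto with analytic. rewrite HFx. now apply Cmult_neq_0.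
  - refine (near_imp2 _ _ _ _ _ Hf HF0). intros z Hfz HFz Hz.
    pose proof (half_plane_minus_ne0 z x Hz) as Hzx.
    assert (E : H z = ((F z - RtoC t) / (z - RtoC x))%C).
    { rewrite (HFH z). field. exact Hzx. }
    pose proof (Cmult_neq_0 _ _ Hzx HFz).
    unfold reduce, tau. rewrite E. destruct a0 as [a|]; rewrite (Hfz Hz); simpl; field; ne0.
Qed.

Lemma avoids_Inf_finite (f : C -> C) (x : R) :
  avoids f x Inf <-> exists G, analytic_near G (RtoC x) /\
    near (RtoC x) (fun z => upper_half_plane z -> f z = G z).
Proof.
  split.
  - intros (P & Q & HP & HQ & Hf & Hy). exists (fun z => (P z / Q z)%C).
    split; [now apply analytic_near_div|]. refine (near_imp _ _ _ _ Hf).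
    intros z Hfz Hz. now apply Hfz.
  - intros (G & HG & Hf). exists G, (fun _ => 1). split; [exact HG|].
    split; [auto with analytic|]. split; [|exact C1_nz].
    refine (near_imp _ _ _ _ Hf). intros z Hfz Hz. split; [exact C1_nz|].
    rewrite (Hfz Hz). field.
Qed.

(** If [g = G] is finite at [x], then with [h = z - x] one has [tau - g = D / (t h)] and [D = 1] at
    [x]. So the difference quotient of the augmentation is [t / D], for finite and infinite [a0]
    alike. *)
Lemma augment_creates_data (g : C -> C) (x t : R) (a0 : onept R) :
  t <> 0 -> avoids g x Inf -> boundary_data (augment a0 t x g) x a0 t.
Proof.
  intros Ht Hg. pose proof (RtoC_ne0 t Ht) as Ht'.
  apply avoids_Inf_finite in Hg. destruct Hg as (G & HG & Hg).
  set (D := fun z => (1 - RtoC t * (z - RtoC x) * G z)%C).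
  assert (HD : analytic_near D (RtoC x)) by (unfold D; auto 10 with analytic).
  assert (HDx : D (RtoC x) = 1) by (unfold D; ring).
  exists (fun z => (RtoC t / D z)%C). split; [|split].
  - apply analytic_near_div; auto with analytic. rewrite HDx. apply C1_nz.
  - rewrite HDx. field.
  - refine (near_imp2 _ _ _ _ _ Hg (analytic_near_ne0 D (RtoC x) HD _)).
    + intros z Hgz HDz Hz. pose proof (half_plane_minus_ne0 z x Hz) as Hzx.
      unfold augment, tau. unfold D in *.
      destruct a0 as [a|]; rewrite (Hgz Hz); simpl; field; ne0.
    + rewrite HDx. apply C1_nz.
Qed.

(** * Both steps preserve the Pick class *)

Lemma Im_inv_pos (u : C) : Im u < 0 -> 0 < Im (1 / u)%C.
Proof.
  intros Hu. destruct u as [p q].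
  replace (Im (1 / (p, q))%C) with (- q / (p ^ 2 + q ^ 2)).
  - simpl in Hu. apply Rdiv_lt_0_compat; [lra|]. nra.
  - unfold Cdiv. rewrite Cmult_1_l. reflexivity.
Qed.

Lemma Im_opp_inv_nonneg (u : C) : 0 <= Im u -> 0 <= Im (- (1 / u))%C.
Proof.
  intros Hu. rewrite im_opp. destruct u as [p q].
  replace (Im (1 / (p, q))%C) with (- (q / (p ^ 2 + q ^ 2))).
  - simpl in Hu. rewrite Ropp_involutive. destruct Hu as [Hu|Hu].
    + left. apply Rdiv_lt_0_compat; [exact Hu|]. nra.
    + rewrite <- Hu. right. unfold Rdiv. ring.
  - unfold Cdiv. rewrite Cmult_1_l. unfold Cinv, Im. simpl. unfold Rdiv. ring.
Qed.

Lemma Im_tau_minus (t x : R) (z w : C) :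
  0 < t -> upper_half_plane z -> 0 <= Im w -> Im (tau t x z - w)%C < 0.
Proof.
  intros Ht Hz Hw. unfold tau, Cminus at 1. rewrite im_plus, im_opp, Im_tau by assumption.
  enough (0 < Im z / (t * ((Re z - x) ^ 2 + Im z ^ 2))) by lra.
  apply Rdiv_lt_0_compat; [exact Hz|].
  apply Rmult_lt_0_compat; [exact Ht|]. apply sum_squares_pos, Hz.
Qed.

Lemma tau_minus_ne0 (t x : R) (g : C -> C) : 0 < t -> Pick_class g ->
  forall z, upper_half_plane z -> (tau t x z - g z)%C <> 0.
Proof.
  intros Ht Hg z Hz E.
  pose proof (Im_tau_minus t x z (g z) Ht Hz (proj2 (Hg z Hz))) as H.
  rewrite E, im_RtoC in H. lra.
Qed.

Lemma analytic_tau (t x : R) (z : C) : t <> 0 -> upper_half_plane z ->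
  analytic_at (tau t x) z.
Proof.
  intros Ht Hz. apply analytic_div; [apply analytic_const|..].
  - apply analytic_mult; [apply analytic_const|].
    apply analytic_minus; [apply analytic_id|apply analytic_const].
  - apply Cmult_neq_0; [now apply RtoC_ne0|]. now apply half_plane_minus_ne0.
Qed.

Lemma Pick_augment (g : C -> C) (x t : R) (a0 : onept R) :
  0 < t -> Pick_class g -> Pick_class (augment a0 t x g).
Proof.
  intros Ht Hg z Hz. pose proof (Hg z Hz) as [Hga Hgi].
  pose proof (Im_tau_minus t x z (g z) Ht Hz Hgi) as Hneg.
  pose proof (analytic_tau t x z ltac:(lra) Hz) as Hta.
  destruct a0 as [a|]; unfold augment; split.
  - apply analytic_plus; [apply analytic_const|].
    apply analytic_div; [apply analytic_const|now apply analytic_minus|].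
    now apply tau_minus_ne0.
  - rewrite im_plus, im_RtoC. left. rewrite Rplus_0_l. now apply Im_inv_pos.
  - now apply analytic_minus.
  - unfold Cminus in *. rewrite im_plus, im_opp in *. lra.
Qed.

(** At [x + i r / 2] the imaginary part is [r / 2] times the real part of the difference quotient,
    which is close to [t > 0]. This excludes real constants. *)
Lemma boundary_data_Im_nonzero (f : C -> C) (x a t : R) :
  0 < t -> boundary_data f x (Fin a) t -> exists z, upper_half_plane z /\ Im (f z) <> 0.
Proof.
  intros Ht (F & HF & HFx & Hf).
  pose proof (analytic_cont F _ (near_point _ _ HF) t Ht) as HFt.
  destruct (near_imp2 _ _ _ _ (fun z A B => conj A B) Hf HFt) as (r & Hr & H).
  set (z := (RtoC x + RtoC (r / 2) * Ci)%C).
  assert (Hzx : (z - RtoC x)%C = (RtoC (r / 2) * Ci)%C) by (unfold z; ring).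
  assert (Hz : upper_half_plane z).
  { unfold upper_half_plane, z. rewrite im_plus, im_RtoC, im_scal_l. simpl. lra. }
  exists z. split; [exact Hz|]. destruct (H z) as [H1 H2].
  { unfold Defs.disc. rewrite Hzx, Cmod_mult, Cmod_Ci, Cmod_R, Rabs_pos_eq; lra. }
  rewrite (H1 Hz). unfold jet. rewrite Hzx, im_plus, im_RtoC, <- Cmult_assoc, im_scal_l.
  rewrite im_mult. simpl (Re Ci). simpl (Im Ci).
  pose proof (Rle_lt_trans _ _ _ (re_le_Cmod _) H2) as H3.
  rewrite HFx in H3. unfold Cminus in H3. rewrite re_plus, re_opp, re_RtoC in H3.
  apply Rabs_def2 in H3. assert (0 < r / 2 * Re (F z)) by (apply Rmult_lt_0_compat; lra). lra.
Qed.

(** If [f] took a finite value [a0] in the half-plane, rigidity would make [Im f] vanish throughout,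
    contradicting [t > 0]. Hence [-1 / (f - a0)] is again a Pick function, and Julia's lemma applies
    to it, or to [f] itself when [a0 = Inf]. *)
Lemma Pick_reduce (f : C -> C) (x t : R) (a0 : onept R) :
  0 < t -> Pick_class f -> boundary_data f x a0 t ->
  Pick_class (reduce a0 t x f) /\
  forall z, upper_half_plane z -> match a0 with Fin a => f z <> RtoC a | Inf => True end.
Proof.
  intros Ht Hf Hd.
  destruct (reduce_removable f x t a0 ltac:(lra) Hd) as (G & HG & HfG).
  apply near_point in HG.
  destruct a0 as [a|].
  - assert (Hne : forall z, upper_half_plane z -> f z <> RtoC a).
    { intros z Hz E. destruct (boundary_data_Im_nonzero f x a t Ht Hd) as (z1 & Hz1 & Hn).
      apply Hn, (Pick_Im_zero f z z1 Hf Hz Hz1). now rewrite E, im_RtoC. }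
    split; [|exact Hne].
    assert (Hphi : Pick_class (fun z => (- (1 / (f z - RtoC a)))%C)).
    { intros z Hz. split.
      - apply analytic_opp, analytic_div; [apply analytic_const|..].
        + apply analytic_minus; [apply Hf, Hz|apply analytic_const].
        + apply Cminus_eq_contra, Hne, Hz.
      - apply Im_opp_inv_nonneg. unfold Cminus. rewrite im_plus, im_opp, im_RtoC.
        pose proof (proj2 (Hf z Hz)). lra. }
    intros z Hz. split.
    + apply analytic_plus; [apply Hphi, Hz|]. apply analytic_tau; [lra|exact Hz].
    + apply (Im_remove_pole _ G x t Ht Hphi HG); [|exact Hz].
      refine (near_imp _ _ _ _ HfG). intros u Hu Huz. symmetry. exact (Hu Huz).
  - split; [|auto]. intros z Hz. split.
    + apply analytic_plus; [apply Hf, Hz|]. apply analytic_tau; [lra|exact Hz].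
    + apply (Im_remove_pole _ G x t Ht Hf HG); [|exact Hz].
      refine (near_imp _ _ _ _ HfG). intros u Hu Huz. symmetry. exact (Hu Huz).
Qed.

Lemma augment_is_augmentation (g : C -> C) (x t : R) (a0 : onept R) :
  0 < t -> Pick_class g -> meromorphic_at g x -> is_augmentation g x a0 t (augment a0 t x g).
Proof.
  intros Ht Hg Hm. split; [exact Hg|]. split; [exact Hm|]. split; [exact Ht|].
  intros z Hz. destruct a0 as [a|]; [|reflexivity]. unfold augment.
  pose proof (tau_minus_ne0 t x g Ht Hg z Hz) as Hne.
  fold (tau t x z). set (u := (tau t x z - g z)%C) in *. split.
  - intros E. apply C1_nz. replace (RtoC 1) with (u * (RtoC a + 1 / u - RtoC a))%C
      by (field; exact Hne).
    rewrite E. ring.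
  - replace (RtoC a + 1 / u - RtoC a)%C with (/ u)%C by (field; exact Hne).
    replace (1 / (RtoC t * (z - RtoC x)) - g z)%C with u by reflexivity.
    field. split; [exact Hne|exact C1_nz] || exact Hne.
Qed.

Lemma is_augmentation_eq (g f : C -> C) (x t : R) (a0 : onept R) :
  is_augmentation g x a0 t f -> forall z, upper_half_plane z -> f z = augment a0 t x g z.
Proof.
  intros (Hg & _ & Ht & H) z Hz. specialize (H z Hz). destruct a0 as [a|]; [|exact H].
  destruct H as [Hne H]. pose proof (Cminus_eq_contra _ _ Hne).
  unfold augment. fold (tau t x z) in H. rewrite <- H. field. ne0.
Qed.

Lemma reduce_is_augmentation (f : C -> C) (x t : R) (a0 : onept R) :
  0 < t -> Pick_class f -> boundary_data f x a0 t -> meromorphic_at (reduce a0 t x f) x ->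
  is_augmentation (reduce a0 t x f) x a0 t f.
Proof.
  intros Ht Hf Hd Hm. destruct (Pick_reduce f x t a0 Ht Hf Hd) as [Hp Hne].
  split; [exact Hp|]. split; [exact Hm|]. split; [exact Ht|].
  intros z Hz. specialize (Hne z Hz). unfold reduce. fold (tau t x z).
  destruct a0 as [a|].
  - split; [exact Hne|]. ring.
  - ring.
Qed.

(** * Independence of values off the half-plane; passage to and from extensions *)

Lemma boundary_data_ext (f g : C -> C) (x : R) (w : onept R) (v : R) :
  (forall z, upper_half_plane z -> f z = g z) -> boundary_data f x w v -> boundary_data g x w v.
Proof.
  intros H (F & HF & HFx & Hf). exists F. split; [exact HF|]. split; [exact HFx|].
  refine (near_imp _ _ _ _ Hf). intros z Hz Hzp. rewrite <- H by exact Hzp. auto.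
Qed.

Lemma avoids_ext (f g : C -> C) (x : R) (y : onept R) :
  (forall z, upper_half_plane z -> f z = g z) -> avoids f x y -> avoids g x y.
Proof.
  intros H (P & Q & HP & HQ & Hf & Hy). exists P, Q.
  split; [exact HP|]. split; [exact HQ|]. split; [|exact Hy].
  refine (near_imp _ _ _ _ Hf). intros z Hz Hzp. rewrite <- H by exact Hzp. auto.
Qed.

Lemma Pick_class_ext (f g : C -> C) :
  (forall z, upper_half_plane z -> f z = g z) -> Pick_class f -> Pick_class g.
Proof.
  intros H Hf z Hz. destruct (Hf z Hz) as [Ha Hi]. split; [|now rewrite <- H].
  apply analytic_ext with f; [|exact Ha].
  refine (near_imp _ _ _ _ (upper_half_plane_near z Hz)). exact H.
Qed.

Lemma near_exists_half_plane (x : R) (P : C -> Prop) :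
  near (RtoC x) P -> exists z, upper_half_plane z /\ P z.
Proof.
  intros (r & Hr & H). exists (RtoC x + RtoC (r / 2) * Ci)%C. split.
  - unfold upper_half_plane. rewrite im_plus, im_RtoC, im_scal_l. simpl. lra.
  - apply H. unfold Defs.disc.
    replace (RtoC x + RtoC (r / 2) * Ci - RtoC x)%C with (RtoC (r / 2) * Ci)%C by ring.
    rewrite Cmod_mult, Cmod_Ci, Cmod_R, Rabs_pos_eq; lra.
Qed.

Lemma meromorphic_pt_finite (F : C -> onept C) (c k : C) :
  meromorphic_pt F c -> F c = Fin k ->
  exists h, analytic_at h c /\ near c (fun z => F z = Fin (h z)).
Proof.
  intros [(h & r & Hr & Hh & HF)|(m & h & r & _ & _ & _ & _ & HF & _)] E.
  - exists h. split; [exact Hh|]. now exists r.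
  - congruence.
Qed.

(** The coordinates are [(h, 1)], or [(h, (z - x)^m)] at a pole. Analyticity of [h] at the points
    around [x] is recovered from that of [F], which is meromorphic and finite there. *)
Lemma avoids_of_meromorphic (f : C -> C) (x : R) (y : onept R) (F : C -> onept C) :
  meromorphic_extension f x F -> F (RtoC x) <> onept_RtoC y -> avoids f x y.
Proof.
  intros (r & Hr & Hmer & Hf) Hy.
  assert (Hmer' : near (RtoC x) (meromorphic_pt F)) by (exists r; auto).
  assert (Hf' : near (RtoC x) (fun z => upper_half_plane z -> F z = Fin (f z)))
    by (exists r; auto).
  destruct (near_point _ _ Hmer') as
    [(h & s & Hs & Hh & HF)|(m & h & s & Hm & Hs & Hh & Hh0 & HFx & HF)].
  - assert (HF' : near (RtoC x) (fun z => F z = Fin (h z))) by (exists s; auto).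
    exists h, (fun _ => 1). split; [|split; [auto with analytic|split]].
    + refine (near_imp2 _ _ _ _ _ Hmer' (near_near _ _ HF')). intros z Hz HFz.
      destruct (meromorphic_pt_finite F z _ Hz (near_point _ _ HFz)) as (k & Hk & HFk).
      apply analytic_ext with k; [|exact Hk]. refine (near_imp2 _ _ _ _ _ HFz HFk).
      intros u H1 H2. congruence.
    + refine (near_imp2 _ _ _ _ _ HF' Hf'). intros z H1 H2 Hz. split; [exact C1_nz|].
      specialize (H2 Hz). rewrite H1 in H2. injection H2 as <-. field.
    + destruct y as [b|]; [|exact C1_nz]. intros E. apply Hy.
      rewrite (near_point _ _ HF'). simpl. f_equal.
      replace (h (RtoC x)) with (RtoC b + (h (RtoC x) - RtoC b * 1))%C by ring.
      rewrite E. ring.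
  - assert (HF' : near (RtoC x) (fun z => z <> RtoC x ->
        F z = Fin (h z / Cpow (z - RtoC x) m)%C)) by (exists s; auto).
    exists h, (fun z => Cpow (z - RtoC x) m).
    split; [|split; [auto with analytic|split]].
    + refine (near_imp2 _ _ _ _ _ Hmer' (near_near _ _ HF')). intros z Hz HFz.
      destruct (Ceq_dec z (RtoC x)) as [->|Hzx]; [exact Hh|].
      destruct (meromorphic_pt_finite F z _ Hz (near_point _ _ HFz Hzx)) as (k & Hk & HFk).
      apply analytic_ext with (fun u => (k u * Cpow (u - RtoC x) m)%C).
      * refine (near_imp3 _ _ _ _ _ _ HFz HFk (near_ne _ _ Hzx)). intros u H1 H2 Hu.
        specialize (H1 Hu). rewrite H2 in H1. injection H1 as ->. field.
        now apply Cpow_nz, Cminus_eq_contra.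
      * apply analytic_mult; [exact Hk|]. apply analytic_pow, analytic_minus;
          [apply analytic_id|apply analytic_const].
    + refine (near_imp2 _ _ _ _ _ HF' Hf'). intros z H1 H2 Hz.
      pose proof (half_plane_minus_ne0 z x Hz) as Hzx.
      specialize (H1 (half_plane_ne_R z x Hz)). specialize (H2 Hz).
      split; [now apply Cpow_nz|]. rewrite H1 in H2. now injection H2.
    + assert (H0 : Cpow (RtoC x - RtoC x) m = 0).
      { replace (RtoC x - RtoC x)%C with (RtoC 0) by ring.
        destruct m as [|m]; [lia|]. simpl. ring. }
      rewrite H0. destruct y as [b|].
      * rewrite Cmult_0_r. unfold Cminus. now rewrite Copp_0, Cplus_0_r.
      * elim Hy. exact HFx.
Qed.

(** The extension is [P / Q], with value [Inf] where [Q = 0]. If [Q] vanishes at [x], it has a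
    finite order [m] there, being nonzero at nearby points of the half-plane; as [P] is then nonzero
    at [x], this [m] is the order of the pole. *)
Lemma meromorphic_of_avoids (f : C -> C) (x : R) (y : onept R) :
  avoids f x y ->
  exists F, meromorphic_extension f x F /\ F (RtoC x) <> onept_RtoC y.
Proof.
  intros (P & Q & HP & HQ & Hf & Hy).
  set (F := fun z => if Ceq_dec (Q z) 0 then Inf else Fin (P z / Q z)%C).
  assert (HFf : near (RtoC x) (fun z => upper_half_plane z -> F z = Fin (f z))).
  { refine (near_imp _ _ _ _ Hf). intros z Hz Hzp. destruct (Hz Hzp) as [HQz ->].
    unfold F. now destruct (Ceq_dec (Q z) 0). }
  assert (Hreg : near (RtoC x) (fun z => Q z <> 0 -> meromorphic_pt F z)).
  { refine (near_imp2 _ _ _ _ _ HP HQ). intros z HPz HQz Hne. left.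
    destruct (analytic_near_nonzero Q z HQz Hne) as (s & Hs & HQs).
    exists (fun u => (P u / Q u)%C), s. split; [exact Hs|].
    split; [now apply analytic_div|]. intros u Hu. specialize (HQs u Hu).
    unfold F. now destruct (Ceq_dec (Q u) 0). }
  exists F. split.
  - enough (Hmer : near (RtoC x) (meromorphic_pt F)).
    { destruct (near_imp2 _ _ _ _ (fun z A B => conj A B) Hmer HFf) as (r & Hr & H).
      exists r. split; [exact Hr|]. split; intros z Hz; apply H, Hz. }
    destruct (Ceq_dec (Q (RtoC x)) 0) as [HQ0|HQ0].
    2:{ refine (near_imp2 _ _ _ _ _ Hreg (analytic_near_ne0 _ _ HQ HQ0)). auto. }
    destruct (analytic_order Q (RtoC x) (near_point _ _ HQ)) as [Hz|(m & Q1 & HQ1 & HQ1x & Hn)].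
    { exfalso. destruct (near_exists_half_plane x _
        (near_imp2 _ _ _ _ (fun z A B => conj A B) Hz Hf)) as (z & Hzp & Hz1 & Hz2).
      now apply (Hz2 Hzp). }
    pose proof (analytic_near_nonzero Q1 _ HQ1 HQ1x) as HQ1n.
    assert (Hm : (1 <= m)%nat).
    { destruct m as [|m]; [|lia]. elim HQ1x. apply near_point in Hn. rewrite HQ0 in Hn.
      rewrite Hn. simpl. ring. }
    assert (HPx : P (RtoC x) <> 0).
    { destruct y as [b|]; [|contradiction]. rewrite HQ0 in Hy. intros E. apply Hy.
      rewrite E. ring. }
    destruct (near_imp2 _ _ _ _ (fun z A B => conj A B) Hn HQ1n) as (s & Hs & Hns).
    assert (HQne : near (RtoC x) (fun z => z <> RtoC x -> Q z <> 0)).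
    { exists s. split; [exact Hs|]. intros z Hz Hzx. destruct (Hns z Hz) as [-> Hz1].
      apply Cmult_neq_0; [|exact Hz1]. now apply Cpow_nz, Cminus_eq_contra. }
    refine (near_imp2 _ _ _ _ _ Hreg HQne). intros z Hz1 Hz2.
    destruct (Ceq_dec z (RtoC x)) as [->|Hzx]; [|auto].
    right. exists m, (fun u => (P u / Q1 u)%C), s. split; [exact Hm|]. split; [exact Hs|].
    split; [apply analytic_div; auto; exact (near_point _ _ HP)|].
    split; [|split].
    + intros E. apply HPx. replace (P (RtoC x)) with (P (RtoC x) / Q1 (RtoC x) * Q1 (RtoC x))%C
        by (field; exact HQ1x). rewrite E. ring.
    + unfold F. now destruct (Ceq_dec (Q (RtoC x)) 0).
    + intros u Hu Hux. destruct (Hns u Hu) as [HQu HQ1u].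
      pose proof (Cpow_nz _ m (Cminus_eq_contra _ _ Hux)) as Hpw.
      unfold F. destruct (Ceq_dec (Q u) 0) as [E|_].
      * exfalso. rewrite HQu in E. now apply (Cmult_neq_0 _ _ Hpw HQ1u).
      * f_equal. rewrite HQu. field. auto.
  - unfold F. destruct (Ceq_dec (Q (RtoC x)) 0) as [HQ0|HQ0], y as [b|]; try easy.
    intros E. apply (f_equal (fun u => match u with Fin c => c | Inf => RtoC 0 end)) in E.
    cbv beta iota delta [onept_RtoC] in E. apply Hy. rewrite <- E. field. exact HQ0.
Qed.

Lemma boundary_data_of_extension (f F : C -> C) (x w v : R) :
  analytic_extension f x F -> F (RtoC x) = RtoC w -> is_derive F (RtoC x) (RtoC v) ->
  boundary_data f x (Fin w) v.
Proof.
  intros (r & Hr & HF & HFf) Hw [_ Hd].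
  destruct (analytic_near_factor F (RtoC x)) as (G & HG & HFG); [now exists r|].
  exists G. split; [exact HG|]. split.
  - apply Classical_Prop.NNPP. intros Hne. apply Cminus_eq_contra, Cmod_gt_0 in Hne.
    set (e := Cmod (G (RtoC x) - RtoC v)) in *.
    (* At one point [z <> x] near [x], [G z] is within [e / 4] of both the derivative [v] and [G x],
       whereas these two are [e] apart. *)
    assert (He : 0 < e / 4) by lra.
    destruct (Hd (RtoC x) (fun P HP => HP) (mkposreal _ He)) as [del Hdel].
    destruct (near_exists_half_plane x _ (near_imp2 _ _ _ _ (fun z A B => conj A B)
      (ex_intro _ (pos del) (conj (cond_pos del) Hdel))
      (analytic_cont G _ (near_point _ _ HG) (e / 4) He))) as (z & Hz & H1 & H2).
    change (Cmod (F z - F (RtoC x) - (z - RtoC x) * RtoC v)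
            <= e / 4 * Cmod (z - RtoC x)) in H1.
    rewrite (HFG z) in H1.
    replace (F (RtoC x) + (z - RtoC x) * G z - F (RtoC x) - (z - RtoC x) * RtoC v)%C
      with ((G z - RtoC v) * (z - RtoC x))%C in H1 by ring.
    rewrite Cmod_mult in H1. apply Rmult_le_reg_r in H1.
    + pose proof (Cmod_minus_le (G z - RtoC v) (G z - G (RtoC x))) as H3.
      replace (G z - RtoC v - (G z - G (RtoC x)))%C with (G (RtoC x) - RtoC v)%C in H3 by ring.
      fold e in H3. lra.
    + apply Cmod_gt_0. now apply half_plane_minus_ne0.
  - exists r. split; [exact Hr|]. intros z Hz Hzp. rewrite <- HFf by assumption.
    rewrite HFG, Hw. reflexivity.
Qed.

Lemma extension_of_boundary_data (f : C -> C) (x w v : R) :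
  boundary_data f x (Fin w) v ->
  exists F, analytic_extension f x F /\ F (RtoC x) = RtoC w /\ is_derive F (RtoC x) (RtoC v).
Proof.
  intros (G & HG & HGx & Hf).
  exists (fun z => (RtoC w + (z - RtoC x) * G z)%C). split; [|split].
  - assert (HF : analytic_near (fun z => (RtoC w + (z - RtoC x) * G z)%C) (RtoC x))
      by auto 10 with analytic.
    destruct (near_imp2 _ _ _ _ (fun z A B => conj A B) HF Hf) as (r & Hr & H).
    exists r. split; [exact Hr|]. split; intros z Hz; [apply H, Hz|].
    intros Hzp. symmetry. now apply H.
  - ring.
  - split; [apply is_linear_scal_l|].
    intros x' Hx'.
    apply (is_filter_lim_locally_unique (V := AbsRing_NormedModule C_AbsRing)) in Hx'.
    subst x'. intros eps.
    destruct (analytic_cont G _ (near_point _ _ HG) eps (cond_pos eps)) as (r & Hr & H).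
    exists (mkposreal r Hr). intros z Hz.
    change (Cmod (RtoC w + (z - RtoC x) * G z - (RtoC w + (RtoC x - RtoC x) * G (RtoC x))
                  - (z - RtoC x) * RtoC v) <= eps * Cmod (z - RtoC x)).
    replace (RtoC w + (z - RtoC x) * G z - (RtoC w + (RtoC x - RtoC x) * G (RtoC x))
             - (z - RtoC x) * RtoC v)%C
      with ((G z - G (RtoC x)) * (z - RtoC x))%C by (rewrite HGx; ring).
    rewrite Cmod_mult. apply Rmult_le_compat_r; [apply Cmod_ge_0|]. left. now apply H.
Qed.

(** * The recursion *)

Lemma y_rec_S x w v k j : j <> k ->
  y_rec x w v (S k) j =
  y_step (w_rec x w v k k) (1 / (v_rec x w v k k * (x j - x k))) (y_rec x w v k j).
Proof. intros H. cbn [y_rec]. now rewrite (proj2 (Nat.eqb_neq j k) H). Qed.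

Lemma y_rec_diag x w v k : y_rec x w v (S k) k = Inf.
Proof. cbn [y_rec]. now rewrite Nat.eqb_refl. Qed.

(** The invariant satisfied by [f_k]: the nodes from [k] on still carry their jets, the earlier ones
    retain only a forbidden value. It describes the solutions at [k = 1] and the admissible
    parameters at [k = n + 1]. *)
Definition stage (n : nat) (x w v : nat -> R) (k : nat) (f : C -> C) : Prop :=
  Pick_class f /\
  (forall j, (k <= j <= n)%nat ->
     boundary_data f (x j) (w_rec x w v k j) (v_rec x w v k j)) /\
  (forall j, (1 <= j < k)%nat -> avoids f (x j) (y_rec x w v k j)).

Lemma stage_ext n x w v k f g :
  (forall z, upper_half_plane z -> f z = g z) -> stage n x w v k f -> stage n x w v k g.
Proof.
  intros H (H1 & H2 & H3). split; [now apply Pick_class_ext with f|]. split; intros j Hj.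
  - apply boundary_data_ext with f; auto.
  - apply avoids_ext with f; auto.
Qed.

(** The node [k] passes from one list to the other: its jet is traded for finiteness, which is
    avoidance of [Inf], the initial value of the recursion for [y] at that node. *)
Lemma stage_reduce n x w v k f :
  (forall i j : nat, (1 <= i <= n)%nat -> (1 <= j <= n)%nat -> x i = x j -> i = j) ->
  positive_definite n (Pick_matrix x w v) -> (1 <= k <= n)%nat ->
  stage n x w v k f ->
  let g := reduce (w_rec x w v k k) (v_rec x w v k k) (x k) f in
  stage n x w v (S k) g /\ is_augmentation g (x k) (w_rec x w v k k) (v_rec x w v k k) f.
Proof.
  intros Hx HM Hk (Hf & Hdata & Havoid) g.
  assert (Hpos : forall j, (k <= j <= n)%nat -> 0 < v_rec x w v k j).
  { intros j Hj. apply (v_rec_pos n); auto; lia. }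
  assert (Hne : forall j, (1 <= j <= n)%nat -> j <> k -> x j <> x k).
  { intros j Hj Hjk E. apply Hjk, Hx; auto; lia. }
  pose proof (Hpos k ltac:(lia)) as Hposk.
  destruct (Pick_reduce f (x k) _ _ Hposk Hf (Hdata k ltac:(lia))) as [Hg Hfne].
  assert (Hfin : avoids g (x k) Inf).
  { apply avoids_Inf_finite, reduce_removable; [lra|]. apply Hdata. lia. }
  split.
  - split; [exact Hg|]. split; intros j Hj.
    + rewrite w_rec_S, v_rec_S by lia. pose proof (Hpos j ltac:(lia)).
      apply reduce_boundary_data; [lra|lra|apply Hne; lia|apply Hdata; lia].
    + destruct (Nat.eq_dec j k) as [->|Hjk].
      * now rewrite y_rec_diag.
      * rewrite y_rec_S by exact Hjk. apply reduce_avoids; [lra|apply Hne; lia|exact Hfne|].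
        apply Havoid. lia.
  - apply reduce_is_augmentation; auto; [apply Hdata; lia|].
    destruct (meromorphic_of_avoids g (x k) Inf Hfin) as (F & HF & _). now exists F.
Qed.

Lemma stage_augment n x w v k g :
  (forall i j : nat, (1 <= i <= n)%nat -> (1 <= j <= n)%nat -> x i = x j -> i = j) ->
  positive_definite n (Pick_matrix x w v) -> (1 <= k <= n)%nat ->
  stage n x w v (S k) g ->
  let f := augment (w_rec x w v k k) (v_rec x w v k k) (x k) g in
  stage n x w v k f /\ is_augmentation g (x k) (w_rec x w v k k) (v_rec x w v k k) f.
Proof.
  intros Hx HM Hk (Hg & Hdata & Havoid) f.
  assert (Hpos : forall j, (k <= j <= n)%nat -> 0 < v_rec x w v k j).
  { intros j Hj. apply (v_rec_pos n); auto; lia. }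
  assert (Hne : forall j, (1 <= j <= n)%nat -> j <> k -> x j <> x k).
  { intros j Hj Hjk E. apply Hjk, Hx; auto; lia. }
  pose proof (Hpos k ltac:(lia)) as Hposk.
  assert (Hfin : avoids g (x k) Inf).
  { rewrite <- (y_rec_diag x w v k). apply Havoid. lia. }
  split.
  - split; [now apply Pick_augment|]. split; intros j Hj.
    + destruct (Nat.eq_dec j k) as [->|Hjk].
      * apply augment_creates_data; [lra|exact Hfin].
      * pose proof (Hpos j Hj).
        apply augment_boundary_data; [lra|lra|apply Hne; lia|].
        rewrite <- w_rec_S, <- v_rec_S by lia. apply Hdata. lia.
    + apply augment_avoids; [lra|apply Hne; lia|now apply tau_minus_ne0|].
      rewrite <- y_rec_S by lia. apply Havoid. lia.
  - apply augment_is_augmentation; auto.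
    destruct (meromorphic_of_avoids g (x k) Inf Hfin) as (F & HF & _). now exists F.
Qed.

Lemma admissible_stage n x w v g :
  admissible_parameter n x (y_rec x w v (S n)) g <-> stage n x w v (S n) g.
Proof.
  split.
  - intros [Hg H]. split; [exact Hg|]. split; intros j Hj; [lia|].
    destruct (H j ltac:(lia)) as (F & HF & Hy). now apply avoids_of_meromorphic with F.
  - intros (Hg & _ & H). split; [exact Hg|]. intros j Hj.
    apply meromorphic_of_avoids, H. lia.
Qed.

Lemma solution_stage n x w v f : dNPP_solution n x w v f <-> stage n x w v 1 f.
Proof.
  split.
  - intros [Hf H]. split; [exact Hf|]. split; intros j Hj; [|lia].
    destruct (H j Hj) as (F & HF & Hw & Hv). now apply boundary_data_of_extension with F.
  - intros (Hf & H & _). split; [exact Hf|]. intros j Hj.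
    apply extension_of_boundary_data. exact (H j Hj).
Qed.

(** Descending induction, with [d] counting the augmentations performed. A chain determines its
    members on the half-plane only, hence the detour through [stage_ext]. *)
Lemma stage_chain n x w v fs :
  (forall i j : nat, (1 <= i <= n)%nat -> (1 <= j <= n)%nat -> x i = x j -> i = j) ->
  positive_definite n (Pick_matrix x w v) ->
  augmentation_chain n x (fun j => w_rec x w v j j) (fun j => v_rec x w v j j) fs ->
  stage n x w v (S n) (fs (S n)) ->
  forall d, (d <= n)%nat -> stage n x w v (S n - d) (fs (S n - d)%nat).
Proof.
  intros Hx HM Hfs Htop d. induction d as [|d IH]; intros Hd.
  - now rewrite Nat.sub_0_r.
  - specialize (IH ltac:(lia)). set (k := (S n - S d)%nat).
    replace (S n - d)%nat with (S k) in IH by lia.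
    assert (Hk : (1 <= k <= n)%nat) by lia.
    apply stage_ext with (augment (w_rec x w v k k) (v_rec x w v k k) (x k) (fs (S k))).
    + intros z Hz. symmetry. apply (is_augmentation_eq _ _ _ _ _ (Hfs k Hk) z Hz).
    + now apply stage_augment.
Qed.

(** Index [k] holds [f_k], starting from [f_1 = f]; index [0] is a default. *)
Fixpoint reductions (x w v : nat -> R) (f : C -> C) (k : nat) : C -> C :=
  match k with
  | O => f
  | S k' => match k' with
            | O => f
            | S _ => reduce (w_rec x w v k' k') (v_rec x w v k' k') (x k')
                       (reductions x w v f k')
            end
  end.

(** Depth [d] holds [f_(n+1-d)], since the recursion descends from [f_(n+1) = g]. *)
Fixpoint augmentations (n : nat) (x w v : nat -> R) (g : C -> C) (d : nat) : C -> C :=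
  match d with
  | O => g
  | S d' => let k := (n - d')%nat in
      augment (w_rec x w v k k) (v_rec x w v k k) (x k) (augmentations n x w v g d')
  end.

Theorem theorem2p2 (n : nat) (x w v : nat -> R)
  (hn : (1 <= n)%nat)
  (hx : forall i j : nat, (1 <= i <= n)%nat -> (1 <= j <= n)%nat ->
          x i = x j -> i = j)
  (hv : forall j : nat, (1 <= j <= n)%nat -> 0 <= v j)
  (hM : positive_definite n (Pick_matrix x w v)) :
  exists (s : nat -> onept R) (t : nat -> R) (y : nat -> onept R),
    (forall j : nat, (1 <= j <= n)%nat -> 0 < t j) /\
    (* the recursion can be carried out from every admissible [g] *)
    (forall g : C -> C, admissible_parameter n x y g ->
       exists fs : nat -> C -> C,
         fs (S n) = g /\ augmentation_chain n x s t fs) /\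
    (forall f : C -> C,
       dNPP_solution n x w v f <->
       exists fs : nat -> C -> C,
         admissible_parameter n x y (fs (S n)) /\
         augmentation_chain n x s t fs /\
         (forall z : C, upper_half_plane z -> f z = fs 1%nat z)) /\
    (forall j : nat, (1 <= j <= n)%nat ->
       s j = w_rec x w v j j /\
       t j = v_rec x w v j j /\
       y j = y_rec x w v (S n) j).
Proof.
  set (s := fun j => w_rec x w v j j). set (t := fun j => v_rec x w v j j).
  exists s, t, (y_rec x w v (S n)).
  split; [|split; [|split]].
  - intros j Hj. apply (v_rec_pos n); auto; lia.
  - intros g Hg. apply admissible_stage in Hg.
    (* Depth is converted back to index, so that [fs k] is [f_k]. *)
    set (fs := fun k => augmentations n x w v g (S n - k)).
    assert (Hstep : forall k, (1 <= k <= n)%nat ->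
      fs k = augment (w_rec x w v k k) (v_rec x w v k k) (x k) (fs (S k))).
    { intros k Hk. unfold fs. replace (S n - k)%nat with (S (n - k)) by lia. simpl.
      replace (n - (n - k))%nat with k by lia. reflexivity. }
    exists fs. split; [unfold fs; now rewrite Nat.sub_diag|].
    assert (Hst : forall d, (d <= n)%nat -> stage n x w v (S n - d) (fs (S n - d)%nat)).
    { induction d as [|d IH]; intros Hd.
      - unfold fs. now rewrite Nat.sub_0_r, Nat.sub_diag.
      - specialize (IH ltac:(lia)). set (k := (S n - S d)%nat).
        replace (S n - d)%nat with (S k) in IH by lia.
        rewrite Hstep by lia. apply stage_augment; auto. lia. }
    intros k Hk. rewrite (Hstep k Hk). apply (stage_augment n); auto.
    replace (S k) with (S n - (n - k))%nat by lia. apply Hst. lia.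
  - intros f. rewrite solution_stage. split.
    (* Successive reductions of a solution recover its whole chain and end in the parameter. *)
    + intros Hf. set (fs := reductions x w v f).
      assert (Hst : forall k, (k <= n)%nat -> stage n x w v (S k) (fs (S k))).
      { induction k as [|k IH]; intros Hk; [exact Hf|].
        exact (proj1 (stage_reduce n x w v (S k) _ hx hM ltac:(lia) (IH ltac:(lia)))). }
      exists fs. split; [|split].
      * apply admissible_stage, Hst. lia.
      * intros [|k] Hk; [lia|].
        exact (proj2 (stage_reduce n x w v (S k) _ hx hM Hk (Hst k ltac:(lia)))).
      * reflexivity.
    + intros (fs & Hadm & Hch & Heq). apply admissible_stage in Hadm.
      apply stage_ext with (fs 1%nat).
      { intros z Hz. symmetry. now apply Heq. }
      replace 1%nat with (S n - n)%nat by lia.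
      now apply stage_chain.
  - intros j _. auto.
Qed.
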